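(* Let $d\ge 2$. For each $n\in\mathbb{N}$, the functional $K\mapsto \mathbb{E}\,W(K^{(n)})/W(K)$, defined for convex bodies $K\subset\mathbb{R}^d$ with interior points, attains its maximum at balls.
   Context: A convex body is a nonempty compact convex subset of $\mathbb{R}^d$. $W(M)$ denotes the mean width of a convex body $M$: $W(M)=\frac{2}{\sigma(S^{d-1})}\int_{S^{d-1}}h(M,u)\,\mathrm{d}\sigma(u)$, where $S^{d-1}$ is the unit sphere, $\sigma$ is spherical Lebesgue measure on $S^{d-1}$, and $h(M,u)=\max_{x\in M}\langle x,u\rangle$ is the support function. $B^d$ is the closed unit ball centered at the origin. Random polytope $K^{(n)}$, for a convex body $K$ with interior points. Put $K_1:=K+B^d$, the parallel body of $K$ at distance $1$. Let $\mathcal{H}$ be the space of hyperplanes in $\mathbb{R}^d$ (usual topology), and let $\mathcal{H}_K\subset\mathcal{H}$ be the set of hyperplanes that meet $K_1$ but not the interior of $K$. For $H\in\mathcal{H}_K$, $H^-$ denotes the closed halfspace bounded by $H$ that contains $K$. Let $\mu$ be the motion invariant Borel measure on $\mathcal{H}$ normalized so that $\mu(\{H\in\mathcal{H}:H\cap M\ne\emptyset\})=W(M)$ for every convex body $M$. Let $\mu_K$ be the measure such that $2\mu_K$ is the restriction of $\mu$ to $\mathcal{H}_K$; it is a probability measure, since $\mu(\mathcal{H}_K)=W(K+B^d)-W(K)=W(B^d)=2$. Let $H_1,\dots,H_n$ be independent random hyperplanes, each with distribution $\mu_K$, and put $$K^{(n)}:=\bigcap_{i=1}^n H_i^-\cap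 K_1 .$$ $\mathbb{E}$ denotes mathematical expectation.
   Formalization: The maximum is taken among convex bodies of a given mean width w > 0: over all convex bodies with interior points the functional is unbounded (for a ball of radius r it is at least 1 + 1/((n+1)r)), so no maximum exists. *)

(* Defs.v *)
From HB Require Import structures.
From mathcomp Require Import all_boot all_order all_algebra.
From mathcomp Require Import all_classical all_reals all_analysis.
From mathcomp Require Import measurable_realfun.
Set Implicit Arguments.
Unset Strict Implicit.
Unset Printing Implicit Defensive.
Import Order.TTheory GRing.Theory Num.Theory.
Import numFieldNormedType.Exports.
Local Open Scope classical_set_scope.
Local Open Scope ring_scope.

(* The norm that the library puts on 'rV[R]_n is the sup norm; it induces the
   Euclidean topology, but lengths below are measured with enorm. *)
Definition dot (R : realType) (n : nat) (x y : 'rV[R]_n) : R :=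
  \sum_(i < n) x 0 i * y 0 i.

Definition enorm (R : realType) (n : nat) (x : 'rV[R]_n) : R :=
  Num.sqrt (dot x x).

Definition borelRn (R : realType) (n : nat) :=
  g_sigma_algebraType (@open 'rV[R]_n).

Section measurability_Rn.
Context (R : realType).

Lemma open_measurableRn n (A : set 'rV[R]_n) :
  open A -> measurable (A : set (borelRn R n)).
Proof. exact: sub_sigma_algebra. Qed.

Lemma continuous_enorm n : continuous (@enorm R n).
Proof.
move=> x; rewrite /enorm.
apply: (@continuous_comp _ _ _ (fun x : 'rV[R]_n => dot x x)); last first.
  exact: sqrt_continuous.
rewrite /dot; apply: continuous_big => [|i _ {}x].
  exact: add_continuous.
by apply: continuousM; exact: coord_continuous.
Qed.

Lemma measurable_fun_borelRn d (T : measurableType d) n (f : T -> borelRn R n) :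
  (forall B : set 'rV[R]_n, open B -> measurable (f @^-1` B)) ->
  measurable_fun [set: T] f.
Proof.
move=> h.
apply: (@measurability _ _ T (borelRn R n) _ f (@open 'rV[R]_n)) => //.
by move=> _ [B oB <-]; rewrite setTI; exact: h.
Qed.

Lemma measurable_continuousRn m n (f : 'rV[R]_m -> 'rV[R]_n) :
  continuous f ->
  measurable_fun [set: borelRn R m] (f : borelRn R m -> borelRn R n).
Proof.
move=> /continuousP cf; apply: measurable_fun_borelRn => B oB.
apply: open_measurableRn; exact: cf.
Qed.

Definition consRn n (p : R * 'rV[R]_n) : 'rV[R]_n.+1 :=
  \row_(i < n.+1) oapp (p.2 0) p.1 (unlift 0 i).

Definition tailRn n (x : 'rV[R]_n.+1) : 'rV[R]_n :=
  \row_(i < n) x 0 (lift 0 i).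

Lemma consRnK n (x : 'rV[R]_n.+1) : consRn (x 0 0, tailRn x) = x.
Proof.
apply/rowP => i; rewrite mxE; case: unliftP => [j|] -> //=.
by rewrite mxE.
Qed.

Lemma consRnE0 n (p : R * 'rV[R]_n) : consRn p 0 0 = p.1.
Proof. by rewrite mxE unlift_none. Qed.

Lemma tailRnK n (p : R * 'rV[R]_n) : tailRn (consRn p) = p.2.
Proof. by apply/rowP => i; rewrite !mxE liftK. Qed.

Lemma ball_rowP n (x y : 'rV[R]_n) (e : R) : 0 < e ->
  ball x e y <-> forall i, `|x 0 i - y 0 i| < e.
Proof.
move=> e0; split=> [[_ h] i|h]; first exact: h.
by split => // i j; rewrite (ord1 i); exact: h.
Qed.

Lemma consRn_ball n (x : 'rV[R]_n.+1) (e : R) : 0 < e ->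
  @consRn n @^-1` ball x e = ball (x 0 0) e `*` ball (tailRn x) e.
Proof.
move=> e0; apply/seteqP; split => -[a v] /=.
  move=> /ball_rowP-/(_ e0) h; split.
    by have := h 0; rewrite consRnE0.
  by apply/ball_rowP => // i; have := h (lift 0 i); rewrite !mxE liftK.
move=> [h0 /ball_rowP-/(_ e0) h]; apply/ball_rowP => // i.
rewrite [consRn _ _ _]mxE; case: unliftP => [j|] -> //=.
by have := h j; rewrite mxE.
Qed.

Lemma open_rat_balls n (A : set 'rV[R]_n) : open A ->
  A = \bigcup_(p in [set p : 'rV[rat]_n * nat |
          ball (map_mx ratr p.1 : 'rV[R]_n) p.2.+1%:R^-1 `<=` A])
        ball (map_mx ratr p.1 : 'rV[R]_n) p.2.+1%:R^-1.
Proof.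
move=> oA; apply/seteqP; split; last by move=> x [p /= pA px]; exact: pA.
move=> x Ax.
have [e /= e0 eA] : exists2 e : R, 0 < e & ball x e `<=` A.
  by have /nbhs_ballP[e e0 eA] := open_nbhs_nbhs (conj oA Ax); exists e.
have [k ke] : exists k : nat, k.+1%:R^-1 < e / 2.
  have e20 : 0 < e / 2 by rewrite divr_gt0.
  exists (Num.truncn (e / 2)^-1).
  rewrite invf_plt ?posrE//.
  exact: truncnS_gt.
set r : R := k.+1%:R^-1.
have r0 : 0 < r by rewrite invr_gt0.
have hq (i : 'I_n) : {q : rat | `|ratr q - x 0 i| < r}.
  apply/cid; have : x 0 i - r < x 0 i + r by rewrite ltrD2l gtrN.
  move=> /rat_in_itvoo[q]; rewrite in_itv/= => /andP[q1 q2]; exists q.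
  by rewrite ltr_distl q1.
pose q : 'rV[rat]_n := \row_i sval (hq i).
exists (q, k) => /=; last first.
  by apply/ball_rowP => // i; rewrite !mxE; exact: (svalP (hq i)).
move=> y /ball_rowP-/(_ r0) hy; apply: eA; apply/ball_rowP => // i.
have := svalP (hq i); have := hy i; rewrite !mxE => h1 h2.
rewrite [e](splitr e).
apply: (le_lt_trans (ler_distD (ratr (sval (hq i))) _ _)).
apply: ltrD; last exact: lt_trans ke.
by rewrite distrC; exact: lt_trans ke.
Qed.

Lemma measurable_consRn n :
  measurable_fun [set: measurableTypeR R * borelRn R n]
    (@consRn n : measurableTypeR R * borelRn R n -> borelRn R n.+1).
Proof.
apply: measurable_fun_borelRn => B oB.
rewrite (open_rat_balls oB) preimage_bigcup bigcup_mkcond.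
apply: countable_bigcupT_measurable => [|p]; first exact: countableP.
case: ifPn => // _; rewrite consRn_ball ?invr_gt0//.
apply: measurableX; first by exact: measurable_ball.
by apply: open_measurableRn; apply: ball_open; rewrite invr_gt0.
Qed.

Lemma continuous_tailRn n : continuous (@tailRn n).
Proof.
move=> x A /nbhs_ballP[e /= e0 eA]; apply/nbhs_ballP; exists e => //= y.
move=> /ball_rowP-/(_ e0) h; apply: eA; apply/ball_rowP => // i.
by rewrite !mxE.
Qed.

Lemma measurable_unconsRn n :
  measurable_fun [set: borelRn R n.+1]
    ((fun x => (x 0 0, tailRn x)) : borelRn R n.+1 -> measurableTypeR R * borelRn R n).
Proof.
apply/measurable_fun_pair => /=; last first.
  by apply: measurable_continuousRn; exact: continuous_tailRn.
apply: (measurability _ (RGenOpens.measurableE R)) => _ [_ [a [b ->]] <-].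
rewrite setTI; apply: open_measurableRn.
apply: open_comp; last exact: interval_open.
by move=> x _; exact: coord_continuous.
Qed.

End measurability_Rn.

Section lebesgue_step.
Context (R : realType) (n : nat).
Variable m : {sigma_finite_measure set (borelRn R n) -> \bar R}.

Let cons : measurableTypeR R * borelRn R n -> borelRn R n.+1 := @consRn R n.
Let mcons : measurable_fun [set: measurableTypeR R * borelRn R n] cons.
Proof. exact: measurable_consRn. Qed.
HB.instance Definition _ := isMeasurableFun.Build _ _ _ _ cons mcons.

Definition lebesgue_step : set (borelRn R n.+1) -> \bar R :=
  pushforward (@lebesgue_measure R \x m)%E cons.

Let lebesgue_step0 : lebesgue_step set0 = 0%E.
Proof. exact: measure0. Qed.

Let lebesgue_step_ge0 A : (0 <= lebesgue_step A)%E.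
Proof. exact: measure_ge0. Qed.

Let lebesgue_step_sigma_additive : semi_sigma_additive lebesgue_step.
Proof. exact: measure_semi_sigma_additive. Qed.

HB.instance Definition _ := isMeasure.Build _ _ _ lebesgue_step
  lebesgue_step0 lebesgue_step_ge0 lebesgue_step_sigma_additive.

Let lebesgue_step_sigma_finite : sigma_finite setT lebesgue_step.
Proof.
have /sigma_finiteP[F [FT ndF Foo]] := sigma_finiteT (@lebesgue_measure R).
have /sigma_finiteP[G [GT ndG Goo]] := sigma_finiteT m.
pose uncons : borelRn R n.+1 -> measurableTypeR R * borelRn R n :=
  fun x : 'rV[R]_n.+1 => (x 0 0, tailRn x).
exists (fun k => uncons @^-1` (F k `*` G k)).
  apply/esym/seteqP; split => // x _.
  have [i _ Fi] : (\bigcup_i F i) (uncons x).1 by rewrite -FT.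
  have [j _ Gj] : (\bigcup_i G i) (uncons x).2 by rewrite -GT.
  exists (maxn i j) => //; split.
    by move: Fi; exact/subsetPset/ndF/leq_maxl.
  by move: Gj; exact/subsetPset/ndG/leq_maxr.
move=> k; have [mF Fk] := Foo k; have [mG Gk] := Goo k; split.
  rewrite -[X in measurable X]setTI; apply: measurable_unconsRn => //.
  exact: measurableX.
rewrite /lebesgue_step /pushforward.
have -> : cons @^-1` (uncons @^-1` (F k `*` G k)) = F k `*` G k.
  by apply/seteqP; split => -[a v] /=; rewrite /uncons /cons consRnE0 tailRnK.
by rewrite product_measure1E// lte_mul_pinfty// ge0_fin_numE.
Qed.

HB.instance Definition _ := Measure_isSigmaFinite.Build _ _ _ lebesgue_step
  lebesgue_step_sigma_finite.

End lebesgue_step.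

(* 'rV[R]_0 is a point, and n.+1 coordinates carry the product of the Lebesgue
   measures of the first coordinate and of the n others *)
Fixpoint lebesgueRn (R : realType) (n : nat) :
    {sigma_finite_measure set (borelRn R n) -> \bar R} :=
  if n is n'.+1 then lebesgue_step (lebesgueRn R n') else dirac ((0 : 'rV[R]_0) : borelRn R 0).

Section sphere_measure.
Context (R : realType) (n : nat).

Let pball : set (borelRn R n) := [set x : 'rV[R]_n | 0 < enorm x <= 1].

Let mpball : measurable pball.
Proof.
have -> : pball = ((@enorm R n) @^-1` [set r | 0 < r]) `\`
                  ((@enorm R n) @^-1` [set r | 1 < r]).
  apply/seteqP; split => x /=.
    by move=> /andP[x0 x1]; split => //; apply/negP; rewrite -leNgt.
  by move=> [x0 /negP]; rewrite -leNgt => x1; apply/andP; split.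
apply: measurableD; apply: open_measurableRn; apply: open_comp.
- by move=> x _; exact: continuous_enorm.
- exact: open_gt.
- by move=> x _; exact: continuous_enorm.
- exact: open_gt.
Qed.

Let normalize : borelRn R n -> borelRn R n :=
  fun x : 'rV[R]_n => (enorm x)^-1 *: x.

Let mnormalize : measurable_fun [set: borelRn R n] normalize.
Proof.
apply: measurable_fun_borelRn => B oB.
pose E : set 'rV[R]_n := (@enorm R n) @^-1` [set r | r != 0].
have oE : open E.
  apply: open_comp; first by move=> x _; exact: continuous_enorm.
  exact: open_neq.
rewrite -[X in measurable X](setUIDK _ (E : set (borelRn R n))).
apply: measurableU.
  apply: open_measurableRn; rewrite openE => x [xB xE].
  apply: filterI; last exact: open_nbhs_nbhs.
  have cx : {for x, continuous (fun y : 'rV[R]_n => (enorm y)^-1 *: y)}.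
    apply: (@continuousZ _ _ _ (fun y : 'rV[R]_n => (enorm y)^-1) id) => //.
    by apply: continuousV => //; exact: continuous_enorm.
  exact: cx (open_nbhs_nbhs (conj oB xB)).
have [B0|B0] := pselect (B 0).
  rewrite (_ : _ `\` _ = ~` (E : set (borelRn R n))).
    by apply: measurableC; exact: open_measurableRn.
  apply/seteqP; split => x /=; first by case.
  move=> /negP; rewrite negbK => /eqP x0; split; last by rewrite /E/= x0 eqxx.
  by rewrite /normalize x0 invr0 scale0r.
rewrite (_ : _ `\` _ = set0)//.
apply/seteqP; split => x //= [+ /negP]; rewrite negbK => + /eqP x0.
by rewrite /normalize x0 invr0 scale0r.
Qed.

HB.instance Definition _ := isMeasurableFun.Build _ _ _ _ normalize mnormalize.

Let cone : set (borelRn R n) -> \bar R :=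
  pushforward (mrestr (lebesgueRn R n) mpball) normalize.

Let cone0 : cone set0 = 0%E.
Proof. exact: measure0. Qed.

Let cone_ge0 A : (0 <= cone A)%E.
Proof. exact: measure_ge0. Qed.

Let cone_sigma_additive : semi_sigma_additive cone.
Proof. exact: measure_semi_sigma_additive. Qed.

HB.instance Definition _ := isMeasure.Build _ _ _ cone
  cone0 cone_ge0 cone_sigma_additive.

Let scaled_cone : {measure set (borelRn R n) -> \bar R} :=
  mscale (n%:R : R)%:nng cone.

(* cone measure: n times the volume of {r u : u in A, 0 < r <= 1}, which for A
   in the unit sphere is the surface area of A *)
Definition sphere_measure (A : set (borelRn R n)) : \bar R :=
  (n%:R%:E * lebesgueRn R n
     [set x : 'rV[R]_n | A ((enorm x)^-1 *: x)%R /\ (0 < enorm x <= 1)%R])%E.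

Let sphere_measure0 : sphere_measure set0 = 0%E.
Proof. exact: (measure0 scaled_cone). Qed.

Let sphere_measure_ge0 A : (0 <= sphere_measure A)%E.
Proof. exact: (measure_ge0 scaled_cone). Qed.

Let sphere_measure_sigma_additive : semi_sigma_additive sphere_measure.
Proof. exact: (@measure_semi_sigma_additive _ _ _ scaled_cone). Qed.

HB.instance Definition _ := isMeasure.Build _ _ _ sphere_measure
  sphere_measure0 sphere_measure_ge0 sphere_measure_sigma_additive.

End sphere_measure.

Section mean_width.
Context (R : realType) (n : nat).
Implicit Type M : set 'rV[R]_n.

Definition unit_ball : set 'rV[R]_n := [set x | enorm x <= 1].

Definition unit_sphere : set 'rV[R]_n := [set u | enorm u = 1].

Definition convex_body M :=
  [/\ M !=set0, compact M & convex_set (M : set (convex_lmodType 'rV[R]_n))].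

Definition euclidean_ball M :=
  exists c : 'rV[R]_n, exists2 r : R, 0 < r & M = [set x | enorm (x - c) <= r].

Definition support_function M (u : 'rV[R]_n) : R := sup [set dot x u | x in M].

Definition mean_width M : R :=
  2 / fine (@sphere_measure R n unit_sphere) *
  Rintegral (@sphere_measure R n) unit_sphere (support_function M).

Definition parallel_body M : set 'rV[R]_n :=
  [set x + y | x in M & y in unit_ball].

End mean_width.

Section hyperplanes.
Context (R : realType) (n : nat).

Definition hplane (u : 'rV[R]_n) (t : R) : set 'rV[R]_n := [set x | dot x u = t].

Record hyperplane := Hyperplane {
  points :> set 'rV[R]_n;
  pointsP : exists u t, u != 0 /\ points = hplane u t }.

Lemma points_inj : injective points.
Proof.
move=> [A hA] [B hB] /= AB; rewrite AB in hA *.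
by rewrite (Prop_irrelevance hA hB).
Qed.

HB.instance Definition _ := gen_eqMixin hyperplane.
HB.instance Definition _ := gen_choiceMixin hyperplane.

(* The quotient topology of the parametrization (u, t) |-> hplane u t over the
   open set u != 0; restricting to unit vectors u gives the same topology. *)
Definition hyperplane_open : set_system hyperplane := fun U =>
  open [set p : 'rV[R]_n * R |
    p.1 != 0 /\ exists2 H, U H & points H = hplane p.1 p.2].

Let hyperplane_openT : hyperplane_open setT.
Proof.
rewrite /hyperplane_open.
rewrite (_ : [set _ | _] = fst @^-1` (~` [set (0 : 'rV[R]_n)])).
  apply: open_comp; first by move=> p _; exact: cvg_fst.
  apply: closed_openC; apply: accessible_closed_set1.
  by apply: hausdorff_accessible; exact: norm_hausdorff.
apply/seteqP; split=> -[u t] /=; first by case=> /eqP.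
move=> /eqP u0; split => //.
have h : exists v s, v != 0 /\ hplane u t = hplane v s by exists u, t.
by exists (Hyperplane h).
Qed.

Let hyperplane_openI : setI_closed hyperplane_open.
Proof.
move=> U V oU oV; rewrite /hyperplane_open.
have := openI oU oV; congr open; apply/seteqP; split => p /=.
  move=> [[p0 [H UH Hp]] [_ [H' VH' H'p]]]; split => //; exists H => //.
  by split => //; rewrite (points_inj (etrans Hp (esym H'p))).
by move=> [p0 [H [UH VH] Hp]]; split; split => //; exists H.
Qed.

Let hyperplane_open_bigcup (I : Type) (f : I -> set hyperplane) :
  (forall i, hyperplane_open (f i)) -> hyperplane_open (\bigcup_i f i).
Proof.
move=> of_; rewrite /hyperplane_open.
have := @bigcup_open _ _ setT _ (fun i _ => of_ i).
congr open; apply/seteqP; split => p /=.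
  by move=> [i _ [p0 [H fH Hp]]]; split => //; exists H => //; exists i.
by move=> [p0 [H [i _ fH] Hp]]; exists i => //; split => //; exists H.
Qed.

HB.instance Definition _ := isOpenTopological.Build hyperplane
  hyperplane_openT hyperplane_openI hyperplane_open_bigcup.

End hyperplanes.

Section hyperplane_point.
Context (R : realType) (n : nat).

Let axis_hyperplane :
  exists u t, u != 0 /\ hplane (const_mx 1 : 'rV[R]_n.+1) 0 = hplane u t.
Proof.
exists (const_mx 1), 0; split => //.
by apply/eqP => /rowP/(_ 0); rewrite !mxE => /eqP; rewrite oner_eq0.
Qed.

HB.instance Definition _ :=
  isPointed.Build (hyperplane R n.+1) (Hyperplane axis_hyperplane).

End hyperplane_point.

(* measurable spaces are pointed in the library, which rules out R^0 *)
Definition borelH (R : realType) (n : nat) :=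
  g_sigma_algebraType (@open (hyperplane R n.+1)).

Section hyperplane_measures.
Context (R : realType) (n : nat).
Variable mu : {measure set (borelH R n) -> \bar R}.

(* row vectors: the linear part acts by right multiplication *)
Definition rigid_motion (g : 'rV[R]_n.+1 -> 'rV[R]_n.+1) :=
  exists (Q : 'M[R]_n.+1) (b : 'rV[R]_n.+1),
    [/\ Q *m Q^T = 1%:M, \det Q = 1 & g = fun x => x *m Q + b].

Definition motion_invariant :=
  forall g, rigid_motion g ->
  forall A : set (hyperplane R n.+1), measurable (A : set (borelH R n)) ->
    mu [set H' : hyperplane R n.+1 |
        exists2 H : hyperplane R n.+1, A H & points H' = g @` points H] = mu A.

Definition hit (M : set 'rV[R]_n.+1) : set (hyperplane R n.+1) :=
  [set H | points H `&` M !=set0].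

Definition width_normalized :=
  forall M, convex_body M -> mu (hit M) = (mean_width M)%:E.

Definition near_hyperplanes (K : set 'rV[R]_n.+1) : set (hyperplane R n.+1) :=
  hit (parallel_body K) `\` hit K°.

Definition muK (K : set 'rV[R]_n.+1) (A : set (hyperplane R n.+1)) : \bar R :=
  (2^-1%:E * mu (A `&` near_hyperplanes K))%E.

End hyperplane_measures.

Section random_polytope.
Context (R : realType) (n : nat).
Implicit Types (K : set 'rV[R]_n.+1) (H : hyperplane R n.+1).

Definition closed_halfspace_of H (G : set 'rV[R]_n.+1) :=
  exists u t, [/\ u != 0, points H = hplane u t & G = [set x | dot x u <= t]].

(* For K with interior points and H in near_hyperplanes K exactly one of the
   two closed halfspaces bounded by H contains K, so this is that one. *)
Definition Hminus K H : set 'rV[R]_n.+1 :=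
  \bigcap_(G in [set G | closed_halfspace_of H G /\ K `<=` G]) G.

Definition circumscribed K (N : nat) (H : 'I_N -> hyperplane R n.+1) :
    set 'rV[R]_n.+1 :=
  (\bigcap_(i in [set: 'I_N]) Hminus K (H i)) `&` parallel_body K.

End random_polytope.

Definition mutually_independent (R : realType) d d' (T : measurableType d)
    (T' : measurableType d') (P : probability T R) (N : nat)
    (X : 'I_N -> T -> T') :=
  forall (J : {set 'I_N}) (A : 'I_N -> set T'), (forall i, measurable (A i)) ->
  P (\bigcap_(i in [set` J]) (X i @^-1` A i)) =
  (\prod_(i in J) P (X i @^-1` A i))%E.

Record hyperplane_sample (R : realType) (n : nat)
    (mu : {measure set (borelH R n) -> \bar R}) (K : set 'rV[R]_n.+1)
    (N : nat) := HyperplaneSample {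
  sample_display : measure_display;
  outcome : measurableType sample_display;
  prob : probability outcome R;
  hyps : 'I_N -> outcome -> borelH R n;
  hyps_measurable : forall i, measurable_fun setT (hyps i);
  hyps_independent : mutually_independent prob hyps;
  hyps_law : forall i (A : set (borelH R n)), measurable A ->
    prob (hyps i @^-1` A) = muK mu K A }.

Arguments hyps {R n mu K N} s i w : rename.

(* Because the parallel body is taken at the fixed distance 1, this ratio is not
   scale invariant and is unbounded over all bodies (shrink a ball), so its
   maximum is to be understood among bodies with a given denominator. *)
Definition expected_width_ratio (R : realType) (n : nat)
    (mu : {measure set (borelH R n) -> \bar R}) (K : set 'rV[R]_n.+1)
    (N : nat) (s : hyperplane_sample mu K N) : \bar R :=
  ('E_(prob s)[fun w => mean_width (circumscribed K (fun i => hyps s i w))]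
     / (mean_width K)%:E)%E.

(* Main.v *)
From HB Require Import structures.
From mathcomp Require Import all_boot all_order all_algebra.
From mathcomp Require Import all_classical all_reals all_analysis.
From mathcomp Require Import measurable_realfun ring lra.
Require Import Defs.
Set Implicit Arguments.
Unset Strict Implicit.
Unset Printing Implicit Defensive.
Import Order.TTheory GRing.Theory Num.Theory.
Import numFieldNormedType.Exports.
Local Open Scope classical_set_scope.
Local Open Scope ring_scope.

(** Among bodies of a given mean width, balls maximize the expected mean width of
    the circumscribed random polytope because, in suitable coordinates, this
    expectation is concave and rotation invariant in the body.

    The coordinates of a hyperplane near [K] are its outer unit normal [u] and its
    distance [s] to the supporting hyperplane of [K] with normal [u]. Their
    distribution is the same for all bodies ([muK_coordinates]): by motion
    invariance and the normalization, the measure of hyperplanes, written in the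
    normal and the distance to a point interior to [K], is a product of a rotation
    invariant measure on the sphere and Lebesgue measure ([polar_measureX]), and
    subtracting the support function of [K] is a translation on each line of
    constant normal ([polar_measure_shear]). So one random sample [x] of
    coordinates serves all bodies, and the random polytope becomes [cut K x], which
    is described by the inequalities [dot y u <= support_function K u + s] inside
    the parallel body ([circumscribed_cut], [expectation_circumscribed]).

    For a fixed sample these inequalities are linear in the support function, so
    [cut] is superadditive for Minkowski combinations and its mean width is concave
    in [K] ([cut_width_minkowski]). Rotating the body has the effect of rotating
    the sample ([cut_width_move]), which does not change its law. Hence averaging
    rotated copies of [K] preserves the mean width and does not decrease the
    expectation. Repeated averaging makes the support function nearly constant
    ([averaging]); a body of mean width [2 * r] whose support function is nearly
    constant lies in the ball of radius [r + e] around the origin, and replacing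
    that ball by the one of radius [r] costs a factor [1 + e / r]
    ([expected_width_le_ball]).

    The averaging argument has a second use: a Lipschitz function on the sphere has
    the same integral as the nearly constant averages of its rotated copies, so
    rotation invariant measures on the sphere are determined by their total mass
    ([rotation_invariant_measure_unique]); this yields the product structure. *)


(** * Euclidean space and its rotations *)

Section euclidean_space.
Context (R : realType) (n : nat).
Implicit Types (x y z u v : 'rV[R]_n) (Q : 'M[R]_n) (a b : R).

Lemma dotE x y : dot x y = (x *m y^T) 0 0.
Proof. by rewrite mxE; apply: eq_bigr => i _; rewrite mxE. Qed.

Lemma dotC x y : dot x y = dot y x.
Proof. by apply: eq_bigr => i _; rewrite mulrC. Qed.

Lemma dotDl x y z : dot (x + y) z = dot x z + dot y z.
Proof. by rewrite !dotE mulmxDl mxE. Qed.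

Lemma dotZl a x y : dot (a *: x) y = a * dot x y.
Proof. by rewrite !dotE -scalemxAl mxE. Qed.

Lemma dotNl x y : dot (- x) y = - dot x y.
Proof. by rewrite -scaleN1r dotZl mulN1r. Qed.

Lemma dotBl x y z : dot (x - y) z = dot x z - dot y z.
Proof. by rewrite dotDl dotNl. Qed.

Lemma dotDr x y z : dot z (x + y) = dot z x + dot z y.
Proof. by rewrite !(dotC z) dotDl. Qed.

Lemma dotZr a x y : dot x (a *: y) = a * dot x y.
Proof. by rewrite dotC dotZl dotC. Qed.

Lemma dotNr x y : dot x (- y) = - dot x y.
Proof. by rewrite dotC dotNl dotC. Qed.

Lemma dotBr x y z : dot z (x - y) = dot z x - dot z y.
Proof. by rewrite dotDr dotNr. Qed.

Lemma dot0l x : dot 0 x = 0.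
Proof. by rewrite -(scale0r x) dotZl mul0r. Qed.

Lemma dot0r x : dot x 0 = 0.
Proof. by rewrite dotC dot0l. Qed.

Lemma dotxx_ge0 x : 0 <= dot x x.
Proof. by apply: sumr_ge0 => i _; rewrite -expr2 sqr_ge0. Qed.

Lemma dotxx_eq0 x : (dot x x == 0) = (x == 0).
Proof.
apply/eqP/eqP => [x0|->]; last by rewrite dot0l.
apply/rowP => i; rewrite mxE; apply/eqP.
rewrite -sqrf_eq0 expr2; apply/eqP; move: x0 i isT.
by apply: psumr_eq0P => j _; rewrite -expr2 sqr_ge0.
Qed.

Lemma sqr_enorm x : enorm x ^+ 2 = dot x x.
Proof. by rewrite sqr_sqrtr// dotxx_ge0. Qed.

Lemma enorm_ge0 x : 0 <= enorm x.
Proof. exact: sqrtr_ge0. Qed.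

Lemma enorm_eq0 x : (enorm x == 0) = (x == 0).
Proof. by rewrite -dotxx_eq0 -sqr_enorm sqrf_eq0. Qed.

Lemma enorm_gt0 x : (0 < enorm x) = (x != 0).
Proof. by rewrite lt0r enorm_ge0 andbT enorm_eq0. Qed.

Lemma enorm0 : enorm (0 : 'rV[R]_n) = 0.
Proof. by apply/eqP; rewrite enorm_eq0. Qed.

Lemma enormZ a x : enorm (a *: x) = `|a| * enorm x.
Proof.
by rewrite /enorm dotZl dotZr mulrA -expr2 sqrtrM ?sqr_ge0// sqrtr_sqr.
Qed.

Lemma enormN x : enorm (- x) = enorm x.
Proof. by rewrite -scaleN1r enormZ normrN1 mul1r. Qed.

Lemma enorm_distC x y : enorm (x - y) = enorm (y - x).
Proof. by rewrite -enormN opprB. Qed.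

(** Cauchy-Schwarz, from the square of [enorm y *: x - enorm x *: y]. *)
Lemma dot_le_enorm x y : dot x y <= enorm x * enorm y.
Proof.
have [->|x0] := eqVneq x 0; first by rewrite dot0l enorm0 mul0r.
have [->|y0] := eqVneq y 0; first by rewrite dot0r enorm0 mulr0.
have := dotxx_ge0 (enorm y *: x - enorm x *: y).
rewrite dotBl !dotBr !dotZl !dotZr -!sqr_enorm (dotC y x).
have := enorm_gt0 x; have := enorm_gt0 y; rewrite x0 y0 => yp xp h.
have xyp : 0 < enorm x * enorm y by rewrite mulr_gt0.
rewrite -(ler_pM2l xyp); move: h; lra.
Qed.

Lemma ler_enormD x y : enorm (x + y) <= enorm x + enorm y.
Proof.
rewrite -(@ler_pXn2r _ 2)// ?nnegrE ?addr_ge0 ?enorm_ge0//.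
rewrite sqr_enorm dotDl !dotDr -!sqr_enorm (dotC y x).
have := dot_le_enorm x y; lra.
Qed.

Lemma normr_coord_le x i : `|x 0 i| <= enorm x.
Proof.
rewrite -sqrtr_sqr ler_sqrt ?dotxx_ge0// expr2 /dot (bigD1 i)//= lerDl.
by apply: sumr_ge0 => j _; rewrite -expr2 sqr_ge0.
Qed.

Lemma normr_le_enorm x : `|x| <= enorm x.
Proof.
rewrite [leLHS]/Num.Def.normr/= mx_normrE bigmax_le ?enorm_ge0//= => -[i j] _.
by rewrite (ord1 i) normr_coord_le.
Qed.

Lemma enorm_le_sum x : enorm x <= \sum_(i < n) `|x 0 i|.
Proof.
rewrite -(@ler_pXn2r _ 2)// ?nnegrE ?enorm_ge0 ?sumr_ge0//.
rewrite sqr_enorm /dot expr2 mulr_suml ler_sum// => i _.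
apply: (@le_trans _ _ (`|x 0 i| * `|x 0 i|)); first by rewrite -normrM ler_norm.
by rewrite ler_wpM2l// (bigD1 i)//= lerDl sumr_ge0.
Qed.

Lemma enorm_le_norm x : enorm x <= n%:R * `|x|.
Proof.
apply: (le_trans (enorm_le_sum x)).
apply: (@le_trans _ _ (\sum_(i < n) `|x|)); last first.
  by rewrite sumr_const card_ord mulr_natl.
apply: ler_sum => i _; rewrite [leRHS]/Num.Def.normr/= mx_normrE.
exact: (le_bigmax _ (fun ij : 'I_1 * 'I_n => `|x ij.1 ij.2|) (0, i)).
Qed.

Lemma continuous_dotl y : continuous (fun x => dot x y).
Proof.
move=> x; rewrite /dot; apply: continuous_big => [|i _ {}x].
  exact: add_continuous.
by apply: continuousM; [exact: coord_continuous|exact: cst_continuous].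
Qed.

Definition orthogonal_mx Q := Q *m Q^T = 1%:M.

Lemma orthogonal_dot Q x y : orthogonal_mx Q -> dot (x *m Q) (y *m Q) = dot x y.
Proof.
by move=> oQ; rewrite !dotE trmx_mul mulmxA -(mulmxA x) oQ mulmx1.
Qed.

Lemma orthogonal_enorm Q x : orthogonal_mx Q -> enorm (x *m Q) = enorm x.
Proof. by move=> oQ; rewrite /enorm orthogonal_dot. Qed.

Lemma orthogonal_tr Q : orthogonal_mx Q -> orthogonal_mx Q^T.
Proof. by move=> /mulmx1C; rewrite /orthogonal_mx trmxK. Qed.

Lemma orthogonal_mulK Q x : orthogonal_mx Q -> x *m Q *m Q^T = x.
Proof. by move=> oQ; rewrite -mulmxA oQ mulmx1. Qed.

Lemma orthogonal_mulVK Q x : orthogonal_mx Q -> x *m Q^T *m Q = x.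
Proof. by move=> oQ; rewrite -mulmxA (mulmx1C oQ) mulmx1. Qed.

Lemma orthogonal_dotr Q x y : orthogonal_mx Q -> dot (x *m Q) y = dot x (y *m Q^T).
Proof.
by move=> oQ; rewrite -[RHS](orthogonal_dot _ _ oQ) orthogonal_mulVK.
Qed.

Definition rotation Q := orthogonal_mx Q /\ \det Q = 1.

Lemma rotation_tr Q : rotation Q -> rotation Q^T.
Proof. by move=> [/orthogonal_tr oQ dQ]; split => //; rewrite det_tr. Qed.

Definition reflection_mx (a : 'rV[R]_n) : 'M[R]_n := 1%:M - 2 *: (a^T *m a).

Lemma mul_reflection (a : 'rV[R]_n) x : x *m reflection_mx a = x - (2 * dot x a) *: a.
Proof.
rewrite mulmxBr mulmx1 -scalemxAr mulmxA (mx11_scalar (x *m a^T)) -dotE.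
by rewrite mul_scalar_mx scalerA.
Qed.

Lemma reflection_tr (a : 'rV[R]_n) : (reflection_mx a)^T = reflection_mx a.
Proof. by rewrite /reflection_mx linearB/= linearZ/= trmx_mul trmxK trmx1. Qed.

Lemma reflection_orthogonal (a : 'rV[R]_n) : enorm a = 1 -> orthogonal_mx (reflection_mx a).
Proof.
move=> a1; have aa : dot a a = 1 by rewrite -sqr_enorm a1 expr1n.
rewrite /orthogonal_mx reflection_tr; apply/row_matrixP => i.
rewrite !rowE mulmxA mulmx1 !mul_reflection dotBl dotZl aa.
set t := dot _ a; rewrite (_ : 2 * (t - _) = - (2 * t)); last by ring.
by rewrite scaleNr opprK subrK.
Qed.

(** Any two hyperplane reflections are conjugate by the reflection that
    exchanges their normals, hence have the same determinant; as its square is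
    one, a product of two reflections has determinant one. *)
Lemma det_reflection (a b : 'rV[R]_n) : enorm a = 1 -> enorm b = 1 ->
  \det (reflection_mx a) = \det (reflection_mx b).
Proof.
move=> a1 b1; have [->//|ab] := eqVneq a b.
have aa : dot a a = 1 by rewrite -sqr_enorm a1 expr1n.
have bb : dot b b = 1 by rewrite -sqr_enorm b1 expr1n.
pose k := enorm (a - b).
have k0 : k != 0 by rewrite enorm_eq0 subr_eq0.
pose c := k^-1 *: (a - b).
have c1 : enorm c = 1 by rewrite enormZ ger0_norm ?invr_ge0 ?enorm_ge0// mulVf.
have k2 : k ^+ 2 = 2 - 2 * dot a b.
  by rewrite sqr_enorm dotBl !dotBr aa bb (dotC b a); ring.
have swap : a *m reflection_mx c = b.
  rewrite mul_reflection /c dotZr dotBr aa scalerA.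
  rewrite (_ : _ * _ = 1); first by rewrite scale1r opprB addrC subrK.
  have -> : 2 * (k^-1 * (1 - dot a b)) * k^-1 = (2 - 2 * dot a b) / k ^+ 2 by field.
  by rewrite -k2 divff// sqrf_eq0.
have conj : reflection_mx c *m reflection_mx a *m reflection_mx c = reflection_mx b.
  have oc := reflection_orthogonal c1.
  apply/row_matrixP => i; rewrite !rowE !mulmxA; set e := delta_mx 0 i.
  rewrite (mul_reflection a) mulmxBl -scalemxAl swap.
  have := orthogonal_mulK e oc; rewrite reflection_tr => ->.
  by rewrite (mul_reflection b) (orthogonal_dotr _ _ oc) reflection_tr swap.
have /(congr1 determinant) := reflection_orthogonal c1.
rewrite reflection_tr det_mulmx det1 => dc.
by rewrite -conj !det_mulmx mulrAC dc mul1r.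
Qed.

(** This is where dimension at least two enters; with antipodal vectors it
    supplies the rotation by half a turn. *)
Lemma exists_orthogonal_unit u : (1 < n)%N -> exists2 m, enorm m = 1 & dot u m = 0.
Proof.
move=> n1; pose i := Ordinal (ltnW n1); pose j := Ordinal n1.
have ij : i != j by [].
suff [m m0 um] : exists2 m : 'rV[R]_n, m != 0 & dot u m = 0.
  exists ((enorm m)^-1 *: m); last by rewrite dotZr um mulr0.
  by rewrite enormZ ger0_norm ?invr_ge0 ?enorm_ge0// mulVf ?enorm_eq0.
have dd k : dot u (delta_mx 0 k) = u 0 k.
  rewrite /dot (bigD1 k)//= mxE !eqxx mulr1 big1 ?addr0// => l lk.
  by rewrite mxE (negbTE lk) andbF mulr0.
have [ui|ui] := eqVneq (u 0 i) 0.
  exists (delta_mx 0 i); last by rewrite dd.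
  by apply/eqP => /rowP/(_ i)/eqP; rewrite !mxE !eqxx oner_eq0.
exists (u 0 j *: delta_mx 0 i - u 0 i *: delta_mx 0 j).
  apply/eqP => /rowP/(_ j)/eqP; rewrite !mxE !eqxx (eq_sym j) (negbTE ij) andbF.
  by rewrite mulr0 mulr1 sub0r oppr_eq0 (negbTE ui).
by rewrite dotBr !dotZr !dd mulrC subrr.
Qed.

(** A product of two reflections is a rotation by twice the angle between
    their normals: the second normal is taken half way from [u] to [v]. *)
Lemma exists_rotation u v : (1 < n)%N -> enorm u = 1 -> enorm v = 1 ->
  exists2 Q, rotation Q & u *m Q = v.
Proof.
move=> n1 u1 v1.
have uu : dot u u = 1 by rewrite -sqr_enorm u1 expr1n.
have vv : dot v v = 1 by rewrite -sqr_enorm v1 expr1n.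
suff [m m1 vm] : exists2 m, enorm m = 1 & v = (2 * dot u m) *: m - u.
  exists (reflection_mx u *m reflection_mx m).
    split; last first.
      have /(congr1 determinant) := reflection_orthogonal m1.
      by rewrite reflection_tr !det_mulmx det1 (det_reflection u1 m1).
    rewrite /orthogonal_mx trmx_mul mulmxA -(mulmxA _ (reflection_mx m)).
    by rewrite !reflection_orthogonal// mulmx1 reflection_orthogonal.
  rewrite mulmxA (mul_reflection u) uu mulr1 scaler_nat mulr2n opprD addNKr.
  by rewrite mul_reflection dotNl mulrN scaleNr opprK addrC vm.
have [->|uv] := eqVneq v (- u).
  have [m m1 um] := exists_orthogonal_unit u n1.
  by exists m => //; rewrite um mulr0 scale0r sub0r.
pose k := enorm (u + v).
have k0 : k != 0 by rewrite enorm_eq0 addrC addr_eq0.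
exists (k^-1 *: (u + v)).
  by rewrite enormZ ger0_norm ?invr_ge0 ?enorm_ge0// mulVf.
have k2 : k ^+ 2 = 2 + 2 * dot u v.
  by rewrite sqr_enorm dotDl !dotDr uu vv (dotC v u); ring.
rewrite dotZr dotDr uu scalerA.
have -> : 2 * (k^-1 * (1 + dot u v)) * k^-1 = (2 + 2 * dot u v) / k ^+ 2 by field.
by rewrite -k2 divff ?sqrf_eq0// scale1r addrC addKr.
Qed.

End euclidean_space.

(** * Convex bodies and their support functions *)

Section convex_bodies.
Context (R : realType) (n : nat).
Implicit Types (M K : set 'rV[R]_n) (x y z u v p : 'rV[R]_n) (a b r : R).

Lemma convex_setP M : convex_set (M : set (convex_lmodType 'rV[R]_n)) <->
  (forall x y a, 0 <= a <= 1 -> M x -> M y -> M (a *: x + (1 - a) *: y)).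
Proof.
split=> [cM x y a a01 Mx My|cM x y l /set_mem Mx /set_mem My].
  pose l := Itv01 (andP a01).1 (andP a01).2.
  by have /set_mem := cM x y l (mem_set Mx) (mem_set My).
by apply/mem_set; apply: cM => //; apply/andP; split.
Qed.

Lemma convex_bodyP M : convex_body M -> [/\ M !=set0, compact M &
  forall x y a, 0 <= a <= 1 -> M x -> M y -> M (a *: x + (1 - a) *: y)].
Proof. by move=> [? ? /convex_setP ?]. Qed.

Lemma support_function_attained M u : M !=set0 -> compact M ->
  exists2 x, M x & support_function M u = dot x u /\
                   forall y, M y -> dot y u <= dot x u.
Proof.
move=> M0 cM.
have [|x /set_mem Mx xmax] := @compact_EVT_max _ R (fun x => dot x u) M M0 cM.
  exact/continuous_subspaceT/continuous_dotl.
have ubx y : M y -> dot y u <= dot x u by move=> My; exact/xmax/mem_set.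
exists x => //; split => //; apply/eqP; rewrite eq_le; apply/andP; split.
  by apply: ge_sup; [exists (dot x u), x|move=> _ [y My <-]; exact: ubx].
apply: ub_le_sup; last by exists x.
by exists (dot x u) => _ [y My <-]; exact: ubx.
Qed.

Lemma support_function_ge M u x : compact M -> M x -> dot x u <= support_function M u.
Proof.
move=> cM Mx; have M0 : M !=set0 by exists x.
by have [y My [->]] := support_function_attained u M0 cM; apply.
Qed.

Lemma support_function_le M u a : M !=set0 -> compact M ->
  (forall x, M x -> dot x u <= a) -> support_function M u <= a.
Proof.
by move=> M0 cM h; have [x Mx [-> _]] := support_function_attained u M0 cM; exact: h.
Qed.

Lemma support_function_mono M M' u : M !=set0 -> compact M -> compact M' ->
  M `<=` M' -> support_function M u <= support_function M' u.
Proof.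
by move=> M0 cM cM' MM'; apply: support_function_le => // x /MM'; exact: support_function_ge.
Qed.

Lemma support_functionZ M u a : 0 <= a -> M !=set0 -> compact M ->
  support_function M (a *: u) = a * support_function M u.
Proof.
move=> a0 M0 cM; apply/eqP; rewrite eq_le; apply/andP; split.
  apply: support_function_le => // x Mx.
  by rewrite dotZr ler_wpM2l// support_function_ge.
have [x Mx [-> _]] := support_function_attained u M0 cM.
by rewrite -dotZr support_function_ge.
Qed.

(** Moving the direction by [u - v] changes each [dot x u] by at most
    [enorm x * enorm (u - v)]; the constant therefore depends only on a ball
    around the origin containing the body, and rotated copies and averages
    share it. *)
Lemma support_function_lip M r u v : M !=set0 -> compact M ->
  (forall x, M x -> enorm x <= r) ->
  support_function M u - support_function M v <= r * enorm (u - v).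
Proof.
move=> M0 cM Mr; rewrite lerBlDr; apply: support_function_le => // x Mx.
rewrite -lerBlDr (le_trans _ (ler_wpM2r (enorm_ge0 _) (Mr _ Mx)))//.
rewrite (le_trans _ (dot_le_enorm _ _))// dotBr lerB//.
exact: support_function_ge.
Qed.

Lemma compact_enorm_bounded M : compact M ->
  exists2 r, 0 < r & forall x, M x -> enorm x <= r.
Proof.
move=> /compact_bounded [a [_ Ma]].
exists (n%:R * (`|a| + 1) + 1); first by rewrite ltr_wpDl// mulr_ge0// addr_ge0.
move=> x Mx; rewrite (le_trans (enorm_le_norm _))// (@le_trans _ _ (n%:R * (`|a| + 1)))//.
  rewrite ler_wpM2l//; apply: Ma => //.
  by rewrite (le_lt_trans (ler_norm a))// ltrDl.
by rewrite lerDl.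
Qed.

Lemma enorm_lip_continuous (f : 'rV[R]_n -> R) (r : R) :
  (forall u v, f u - f v <= r * enorm (u - v)) -> continuous f.
Proof.
move=> lf u; apply/(@cvgrPdist_le _ _ _ (nbhs u)) => /= e e0.
pose r' := `|r| * n%:R + 1.
have r'0 : 0 < r' by rewrite ltr_wpDl// mulr_ge0.
apply/nbhs_ballP; exists (e / r') => /=; first by rewrite divr_gt0.
move=> v; rewrite -ball_normE /ball_/= => uv.
have {uv} : r' * `|u - v| <= e by rewrite mulrC -ler_pdivlMr// ltW.
have {}lf u' v' : f u' - f v' <= r' * `|u' - v'|.
  rewrite (le_trans (lf _ _))// (@le_trans _ _ (`|r| * enorm (u' - v')))//.
    by rewrite ler_wpM2r ?enorm_ge0// ler_norm.
  rewrite mulrDl mul1r -mulrA ler_wpDr// ler_wpM2l//.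
  exact: enorm_le_norm.
rewrite ler_norml; have := lf u v; have := lf v u; rewrite (distrC v); lra.
Qed.

Lemma support_function_continuous M : M !=set0 -> compact M ->
  continuous (support_function M).
Proof.
move=> M0 cM; have [r _ Mr] := compact_enorm_bounded cM.
by apply: (@enorm_lip_continuous _ r) => u v; exact: support_function_lip.
Qed.

(** * Minkowski combinations *)

Definition minkowski a M b M' : set 'rV[R]_n :=
  [set a *: x + b *: y | x in M & y in M'].

Lemma minkowski_compact a M b M' : compact M -> compact M' -> compact (minkowski a M b M').
Proof.
move=> cM cM'.
have -> : minkowski a M b M' = (fun p : 'rV[R]_n * 'rV[R]_n => a *: p.1 + b *: p.2) @` (M `*` M').
  apply/seteqP; split => [_ [x Mx [y My <-]]|_ [[x y] [/= Mx My] <-]].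
    by exists (x, y).
  by exists x => //; exists y.
apply: continuous_compact; last exact: compact_setX.
apply: continuous_subspaceT => p; apply: cvgD; apply: cvgZr.
  exact: cvg_fst.
exact: cvg_snd.
Qed.

Lemma minkowski_convex_body a M b M' : convex_body M -> convex_body M' ->
  convex_body (minkowski a M b M').
Proof.
move=> /convex_bodyP[[x Mx] cM vM] /convex_bodyP[[y My] cM' vM']; split.
- by exists (a *: x + b *: y), x => //; exists y.
- exact: minkowski_compact.
- apply/convex_setP => _ _ t t01 [x1 Mx1 [y1 My1 <-]] [x2 Mx2 [y2 My2 <-]].
  exists (t *: x1 + (1 - t) *: x2); first exact: vM.
  exists (t *: y1 + (1 - t) *: y2); first exact: vM'.
  rewrite !scalerDr !scalerA !(mulrC _ t) !(mulrC _ (1 - t)).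
  by rewrite -!addrA; congr +%R; rewrite addrCA.
Qed.

Lemma support_function_minkowski a M b M' u : 0 <= a -> 0 <= b ->
  M !=set0 -> compact M -> M' !=set0 -> compact M' ->
  support_function (minkowski a M b M') u =
  a * support_function M u + b * support_function M' u.
Proof.
move=> a0 b0 M0 cM M'0 cM'.
have cmink := @minkowski_compact a M b M' cM cM'.
have [x Mx [ex _]] := support_function_attained u M0 cM.
have [y My [ey _]] := support_function_attained u M'0 cM'.
apply/eqP; rewrite eq_le; apply/andP; split.
  apply: support_function_le => //.
    by exists (a *: x + b *: y), x => //; exists y.
  move=> _ [x' Mx' [y' My' <-]]; rewrite dotDl !dotZl.
  by rewrite lerD// ler_wpM2l// support_function_ge.
rewrite ex ey -!dotZl -dotDl support_function_ge//.
by exists x => //; exists y.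
Qed.

(** * Images under affine isometries *)

Definition move (Q : 'M[R]_n) p x : 'rV[R]_n := x *m Q + p.

Lemma continuous_move Q p : orthogonal_mx Q -> continuous (move Q p).
Proof.
move=> oQ x; apply/(@cvgrPdist_le _ _ _ (nbhs x)) => /= e e0.
pose c : R := n%:R + 1.
have c0 : 0 < c by rewrite ltr_wpDl.
apply/nbhs_ballP; exists (e / c) => /=; first by rewrite divr_gt0.
move=> y; rewrite -ball_normE /ball_/= => xy.
rewrite /move opprD addrACA subrr addr0 -mulmxBl.
rewrite (le_trans (normr_le_enorm _))// orthogonal_enorm//.
rewrite (le_trans (enorm_le_norm _))// (@le_trans _ _ (c * `|x - y|))//.
  by rewrite ler_wpM2r// lerDl.
by rewrite mulrC -ler_pdivlMr// ltW.
Qed.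

Lemma move_convex_body Q p M : orthogonal_mx Q -> convex_body M ->
  convex_body (move Q p @` M).
Proof.
move=> oQ /convex_bodyP[[x Mx] cM vM]; split.
- by exists (move Q p x), x.
- by apply: continuous_compact => //; exact/continuous_subspaceT/continuous_move.
- apply/convex_setP => _ _ t t01 [y My <-] [z Mz <-].
  exists (t *: y + (1 - t) *: z); first exact: vM.
  rewrite /move mulmxDl -!scalemxAl !scalerDr addrACA -(scalerDl p).
  by rewrite [t + _]addrC subrK scale1r.
Qed.

Lemma support_function_move Q p M u : orthogonal_mx Q -> M !=set0 -> compact M ->
  support_function (move Q p @` M) u = support_function M (u *m Q^T) + dot p u.
Proof.
move=> oQ M0 cM.
have cQM : compact (move Q p @` M).
  by apply: continuous_compact => //; exact/continuous_subspaceT/continuous_move.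
have dQ x : dot (move Q p x) u = dot x (u *m Q^T) + dot p u.
  by rewrite /move dotDl orthogonal_dotr.
apply/eqP; rewrite eq_le; apply/andP; split.
  apply: support_function_le => //; first by have [x Mx] := M0; exists (move Q p x), x.
  by move=> _ [x Mx <-]; rewrite dQ lerD2r support_function_ge.
have [x Mx [-> _]] := support_function_attained (u *m Q^T) M0 cM.
by rewrite -dQ support_function_ge//; exists x.
Qed.

(** * Balls *)

Definition eball p r : set 'rV[R]_n := [set x | enorm (x - p) <= r].

Lemma closed_eball p r : closed (eball p r).
Proof.
apply: (@closed_comp _ _ (fun x => enorm (x - p)) [set t | t <= r]); last exact: closed_le.
move=> x _; apply: continuous_comp; last exact: continuous_enorm.
by apply: (@continuousB _ _ _ id (cst p)); [exact: cvg_id|exact: cst_continuous].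
Qed.

Lemma eball_convex_body p r : 0 <= r -> convex_body (eball p r).
Proof.
move=> r0; split.
- by exists p; rewrite /eball/= subrr enorm0.
- apply: bounded_closed_compact; last exact: closed_eball.
  exists (enorm p + r); split => [|a ra x px]; first exact: num_real.
  apply: (le_trans (normr_le_enorm x)); apply: le_trans (ltW ra).

  by rewrite -(subrK p x) addrC (le_trans (ler_enormD _ _))// lerD2l.
- apply/convex_setP => x y t /andP[t0 t1] xr yr; rewrite /eball/=.
  have -> : t *: x + (1 - t) *: y - p = t *: (x - p) + (1 - t) *: (y - p).
    rewrite !scalerBr addrACA -opprD -scalerDl [t + _]addrC subrK scale1r//.
  rewrite (le_trans (ler_enormD _ _))// !enormZ !ger0_norm ?subr_ge0//.
  have := ler_wpM2l t0 xr.
  have := @ler_wpM2l _ (1 - t) _ _ _ yr; rewrite subr_ge0 => /(_ t1); lra.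
Qed.

Lemma compact_unit_sphere : compact (@unit_sphere R n).
Proof.
have [_ cB _] := eball_convex_body 0 (@ler01 R).
apply: (subclosed_compact _ cB).
  apply: (@closed_comp _ _ (@enorm R n) [set 1]); last exact: closed_eq.
  by move=> x _; exact: continuous_enorm.
by move=> u; rewrite /eball/= subr0 => ->.
Qed.

Lemma translate_eball p q r : move 1%:M p @` eball q r = eball (q + p) r.
Proof.
apply/seteqP; split=> [_ [x xr <-]|x xr]; rewrite /eball/= /move.
  by rewrite mulmx1 opprD addrA [x + p - q]addrAC addrK.
by exists (x - p); rewrite ?mulmx1 ?subrK// /eball/= -addrA -opprD [p + q]addrC.
Qed.

Lemma support_function_eball0 r u : 0 <= r -> support_function (eball 0 r) u = r * enorm u.
Proof.
move=> r0; have [b0 cb _] := eball_convex_body 0 r0.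
apply/eqP; rewrite eq_le; apply/andP; split.
  apply: support_function_le => // x; rewrite /eball/= subr0 => xr.
  by rewrite (le_trans (dot_le_enorm _ _))// ler_wpM2r ?enorm_ge0.
have [->|u0] := eqVneq u 0.
  rewrite enorm0 mulr0 -(dot0r (0 : 'rV_n)) support_function_ge//.
  by rewrite /eball/= subrr enorm0.
have nu : enorm u != 0 by rewrite enorm_eq0.
have -> : r * enorm u = dot ((r / enorm u) *: u) u.
  by rewrite dotZl -sqr_enorm expr2 mulrA mulfVK.
apply: support_function_ge => //; rewrite /eball/= subr0 enormZ.
by rewrite ger0_norm ?divr_ge0 ?enorm_ge0// mulfVK.
Qed.

Lemma unit_ballE : @unit_ball R n = eball 0 1.
Proof. by apply/seteqP; split => x; rewrite /unit_ball /eball/= subr0. Qed.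

Lemma parallel_bodyE M : parallel_body M = minkowski 1 M 1 (eball 0 1).
Proof.
rewrite -unit_ballE; apply/seteqP; split => _ [x Mx [y By <-]];
  by exists x => //; exists y => //; rewrite !scale1r.
Qed.

Lemma parallel_body_convex_body M : convex_body M -> convex_body (parallel_body M).
Proof.
by move=> cM; rewrite parallel_bodyE; apply: minkowski_convex_body => //; exact: eball_convex_body.
Qed.

Lemma sub_parallel_body M : M `<=` parallel_body M.
Proof.
by move=> x Mx; exists x => //; exists 0; rewrite ?addr0// /unit_ball/= enorm0.
Qed.

Lemma support_function_parallel_body M u : convex_body M -> 
  support_function (parallel_body M) u = support_function M u + enorm u.
Proof.
move=> [M0 cM _]; have [b0 cb _] := eball_convex_body 0 (@ler01 R).
by rewrite parallel_bodyE support_function_minkowski// support_function_eball0// !mul1r.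
Qed.

Lemma interior_eball M p : M° p -> exists2 r, 0 < r & eball p r `<=` M.
Proof.
move=> /nbhs_ballP[r /= r0 rM]; exists (r / 2) => [|x]; first by rewrite divr_gt0.
rewrite /eball/= => xp; apply: rM; rewrite -ball_normE /ball_/= distrC.
rewrite (le_lt_trans (normr_le_enorm _))// (le_lt_trans xp)//.
by rewrite ltr_pdivrMr// ltr_pMr// ltr1n.
Qed.

(** The topology is that of the sup norm, which the Euclidean norm exceeds by a
    factor at most [n]. *)
Lemma eball_interior M p r : 0 < r -> eball p r `<=` M -> M° p.
Proof.
move=> r0 rM; apply/nbhs_ballP.
have n0 : 0 < (n%:R + 1 : R) by rewrite ltr_wpDl.
exists (r / (n%:R + 1)) => /=; first by rewrite divr_gt0.
move=> x; rewrite -ball_normE /ball_/= distrC => px; apply: rM; rewrite /eball/=.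
rewrite (le_trans (enorm_le_norm _))//.
rewrite (@le_trans _ _ ((n%:R + 1) * `|x - p|))//; first by rewrite ler_wpM2r// lerDl.
by rewrite mulrC -ler_pdivlMr// ltW.
Qed.

End convex_bodies.

(** * Bodies cut out by a sample *)

Section cut_bodies.
Context (R : realType) (n N : nat).
Implicit Types (M K L : set 'rV[R]_n) (y p : 'rV[R]_n) (a b r : R).
Implicit Types (x : 'I_N -> 'rV[R]_n * R).

(** With [x i = (u, s)], the halfspace of outer normal [u] whose boundary lies at
    distance [s] beyond the supporting hyperplane of [K] is intersected for all
    [i] with the parallel body. In these coordinates the sample is decoupled
    from [K]: the same sample can be applied to every body. *)
Definition cut K x : set 'rV[R]_n :=
  [set y | (forall i, dot y (x i).1 <= support_function K (x i).1 + (x i).2) /\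
           parallel_body K y].

Definition admissible : set ('I_N -> 'rV[R]_n * R) :=
  [set x | forall i, enorm (x i).1 = 1 /\ 0 <= (x i).2 <= 1].

Lemma sub_cut K x : convex_body K -> admissible x -> K `<=` cut K x.
Proof.
move=> [_ cK _] Dx y Ky; split => [i|]; last exact: sub_parallel_body.
by have [_ /andP[s0 _]] := Dx i; rewrite ler_wpDr// support_function_ge.
Qed.

Lemma cut_convex_body K x : convex_body K -> admissible x -> convex_body (cut K x).
Proof.
move=> bK Dx; have [[p Kp] cK _] := bK.
have /convex_bodyP[_ cK1 vK1] := parallel_body_convex_body bK.
split; first by exists p; exact: sub_cut.
- apply: (@subclosed_compact _ _ (parallel_body K)) => //; last by move=> y [].
  rewrite (_ : cut K x = (\bigcap_i [set y | dot y (x i).1 <=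
      support_function K (x i).1 + (x i).2]) `&` parallel_body K).
    apply: closedI; last by apply: compact_closed => //; exact: norm_hausdorff.
    apply: closed_bigI => i _.
    apply: (@closed_comp _ _ (fun y => dot y (x i).1) [set t | t <= _]).
      by move=> y _; exact: continuous_dotl.
    exact: closed_le.
  apply/seteqP; split => [y [h1 h2]|y [h1 h2]]; split => // i; first by move=> _; exact: h1.
  exact: h1.
- apply/convex_setP => y z t t01 [y1 y2] [z1 z2]; split; last exact: vK1.
  move=> i; rewrite dotDl !dotZl; set c := leRHS.
  have /andP[t0 t1] := t01.
  have := ler_wpM2l t0 (y1 i).
  have := @ler_wpM2l _ (1 - t) _ _ _ (z1 i); rewrite subr_ge0 => /(_ t1).
  rewrite -/c; lra.
Qed.

Definition rotate_sample (Q : 'M[R]_n) x : 'I_N -> 'rV[R]_n * R :=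
  fun i => ((x i).1 *m Q, (x i).2).

Lemma cut_move Q p K x : orthogonal_mx Q -> convex_body K ->
  cut (move Q p @` K) (rotate_sample Q x) = move Q p @` cut K x.
Proof.
move=> oQ bK; have [K0 cK _] := bK.
have hQ i : support_function (move Q p @` K) (rotate_sample Q x i).1 =
            support_function K (x i).1 + dot p ((x i).1 *m Q).
  by rewrite support_function_move// orthogonal_mulK.
have dQ y i : dot (move Q p y) (rotate_sample Q x i).1 =
              dot y (x i).1 + dot p ((x i).1 *m Q).
  by rewrite dotDl orthogonal_dot.
apply/seteqP; split=> [z [h1 [_ [k Kk <-] [b bb zE]]]|_ [y [h1 [k Kk [b bb yE]]] <-]].
  have zE' : z = move Q p (k + b *m Q^T).
    by rewrite -zE /move mulmxDl orthogonal_mulVK// addrAC.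
  exists (k + b *m Q^T) => //; split => [i|].
    by have := h1 i; rewrite zE' hQ dQ /= addrAC lerD2r.
  exists k => //; exists (b *m Q^T) => //.
  by rewrite /unit_ball/= orthogonal_enorm//; exact: orthogonal_tr.
split => [i|]; first by rewrite hQ dQ /= addrAC lerD2r.
exists (move Q p k); first by exists k.
exists (b *m Q); first by rewrite /unit_ball/= orthogonal_enorm.
by rewrite -yE /move mulmxDl addrAC.
Qed.

(** The defining inequalities of the cut body are linear in the support
    function, and so is the formation of the parallel body; hence sums of points
    of the two cut bodies satisfy the inequalities of the combined one. *)
Lemma cut_minkowski a b M M' x : 0 <= a -> 0 <= b -> a + b = 1 ->
  convex_body M -> convex_body M' ->
  minkowski a (cut M x) b (cut M' x) `<=` cut (minkowski a M b M') x.
Proof.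
move=> a0 b0 ab [M0 cM _] [M'0 cM' _] _ [y [y1 [k Mk [u bu yE]]] [z [z1 [l Ml [v bv zE]]] <-]].
split=> [i|].
  rewrite support_function_minkowski// dotDl !dotZl.
  have := ler_wpM2l a0 (y1 i); have := ler_wpM2l b0 (z1 i).
  set s := (x i).2 => h1 h2; have : a * s + b * s = s by rewrite -mulrDl ab mul1r.
  move: h1 h2; lra.
exists (a *: k + b *: l); first by exists k => //; exists l.
exists (a *: u + b *: v); last by rewrite addrACA -!scalerDr yE zE.
rewrite /unit_ball/= (le_trans (ler_enormD _ _))// !enormZ !ger0_norm//.
by rewrite -ab lerD// -[leRHS]mulr1 ler_wpM2l.
Qed.

Lemma cut_sub K L x : convex_body K -> convex_body L -> K `<=` L -> cut K x `<=` cut L x.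
Proof.
move=> [K0 cK _] [_ cL _] KL y [y1 [k Kk [u bu yE]]]; split => [i|].
  by apply: (le_trans (y1 i)); rewrite lerD2r support_function_mono.
by exists k; [exact: KL|exists u].
Qed.

Lemma scaled_cutP K c x y : 0 < c -> parallel_body K (c^-1 *: y) ->
  (forall i, dot y (x i).1 <= c * (support_function K (x i).1 + (x i).2)) ->
  minkowski c (cut K x) 0 (cut K x) y.
Proof.
move=> c0 Ky h.
have cy : cut K x (c^-1 *: y).
  by split => // i; rewrite dotZl mulrC ler_pdivrMr// mulrC.
exists (c^-1 *: y) => //; exists (c^-1 *: y) => //.
by rewrite scale0r addr0 scalerA divff ?gt_eqF// scale1r.
Qed.

(** Enlarging the radius from [r] to [r + e] adds [e] to each right-hand side
    [r + s], which is at most the factor [1 + e / r] since [s >= 0]. *)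
Lemma cut_eball_sub r e x : 0 < r -> 0 < e -> admissible x ->
  cut (eball 0 (r + e)) x `<=`
  minkowski (1 + e / r) (cut (eball 0 r) x) 0 (cut (eball 0 r) x).
Proof.
move=> r0 e0 Dx y [h1 [k rk [u bu yE]]].
have er0 : 0 < e / r by rewrite divr_gt0.
have re : (1 + e / r) * r = r + e by rewrite mulrDl mul1r divfK// gt_eqF.
have c1 : 1 <= 1 + e / r by rewrite lerDl ltW.
move: (1 + e / r) re c1 => c re c1; have c0 : 0 < c by rewrite (lt_le_trans ltr01).
apply: scaled_cutP => // [|i].
  exists (c^-1 *: k).
    move: rk; rewrite /eball/= !subr0 enormZ ger0_norm ?invr_ge0 ?(ltW c0)//.
    by rewrite mulrC ler_pdivrMr// mulrC re.
  exists (c^-1 *: u); last by rewrite -scalerDr yE.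
  rewrite /unit_ball/= enormZ ger0_norm ?invr_ge0 ?(ltW c0)//.
  by rewrite mulrC ler_pdivrMr// mul1r (le_trans bu).
have [u1 /andP[s0 s1]] := Dx i; have := h1 i.
rewrite !support_function_eball0 ?addr_ge0 ?(ltW r0) ?(ltW e0)// u1 !mulr1 mulrDr re.
by move=> /le_trans; apply; rewrite lerD2l ler_peMl.
Qed.

(** Perturbing the sample by [d] enlarges the cut body at most by a dilatation,
    because the body contains a ball around the origin. *)
Lemma cut_perturb K r0 r1 x x' d e : 0 < r0 -> 0 <= d -> 0 < e -> convex_body K ->
  eball 0 r0 `<=` K -> K `<=` eball 0 r1 ->
  admissible x -> admissible x' ->
  (forall i, enorm ((x i).1 - (x' i).1) <= d /\ `|(x i).2 - (x' i).2| <= d) ->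
  d * (r1 + r1 + 2) <= e * r0 ->
  cut K x `<=` minkowski (1 + e) (cut K x') 0 (cut K x').
Proof.
move=> r0p d0 e0 bK rK Kr Dx Dx' xx' de y [h1 Ky].
have c0 : 0 < 1 + e by rewrite addr_gt0.
have /convex_bodyP[_ cK1 vK1] := parallel_body_convex_body bK.
have [K0 cK _] := bK.
apply: scaled_cutP => // [|i].
  rewrite -[_ *: y]addr0 -(scaler0 _ (1 - (1 + e)^-1)); apply: vK1 => //.
    by rewrite invr_ge0 ltW//= invf_le1// lerDl ltW.
  by apply/sub_parallel_body/rK; rewrite /eball/= subrr enorm0 ltW.
have [u1 /andP[s0 s1]] := Dx i; have [u'1 /andP[s'0 s'1]] := Dx' i.
have [uu' ss'] := xx' i; have := h1 i.
set u := (x i).1; set u' := (x' i).1.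
have yr : enorm y <= r1 + 1.
  have [k Kk [v bv <-]] := Ky; rewrite (le_trans (ler_enormD _ _))// lerD//.
  by have := Kr _ Kk; rewrite /eball/= subr0.
have hr0 : r0 <= support_function K u'.
  have [b0 cb _] := eball_convex_body (0 : 'rV[R]_n) (ltW r0p).
  have := support_function_mono u' b0 cb cK rK.
  by rewrite support_function_eball0 ?(ltW r0p)// u'1 mulr1.
have hl : support_function K u - support_function K u' <= r1 * d.
  rewrite (le_trans (@support_function_lip _ _ _ r1 _ _ K0 cK _))//.
    by move=> z /Kr; rewrite /eball/= subr0.
  have [k Kk] := K0; apply: ler_wpM2l => //.
  by have := Kr _ Kk; rewrite /eball/= => /(le_trans (enorm_ge0 _)).
have yuu : dot y u' - dot y u <= (r1 + 1) * d.
  rewrite -dotBr (le_trans (dot_le_enorm _ _))// enorm_distC ler_pM ?enorm_ge0//.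
have := ler_wpM2l (ltW e0) hr0; have := mulr_ge0 (ltW e0) s'0.
move: ss' de; rewrite ler_norml => /andP[_]; move: hl yuu; rewrite -/u -/u'; lra.
Qed.

End cut_bodies.

(** * Mean width *)

Section borel_maps.
Context (R : realType).

Lemma measurable_fun_open_preimage d (T : measurableType d) (f : T -> measurableTypeR R) :
  (forall B : set R, open B -> measurable (f @^-1` B)) -> measurable_fun [set: T] f.
Proof.
move=> h; apply: (measurability _ (RGenOpens.measurableE R)) => _ [_ [a [b ->]] <-].
by rewrite setTI; apply: h; exact: interval_open.
Qed.

Lemma continuous_borelRn_measurable n (f : 'rV[R]_n -> R) : continuous f ->
  measurable_fun [set: borelRn R n] (f : borelRn R n -> measurableTypeR R).
Proof.
move=> cf; apply: measurable_fun_open_preimage => B oB.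
by apply: open_measurableRn; apply: open_comp => // x _; exact: cf.
Qed.

(** Open sets are countable unions of boxes, and a box is a finite intersection
    of conditions on the coordinates. *)
Lemma measurable_fun_coordinates d (T : measurableType d) n (f : T -> borelRn R n) :
  (forall i, measurable_fun [set: T]
     ((fun t => (f t : 'rV[R]_n) 0 i) : T -> measurableTypeR R)) ->
  measurable_fun [set: T] f.
Proof.
move=> mf; apply: measurable_fun_borelRn => B oB.
rewrite (open_rat_balls oB) preimage_bigcup bigcup_mkcond.
apply: countable_bigcupT_measurable => [|p]; first exact: countableP.
case: ifPn => // _; set c := map_mx _ _; set r := _^-1.
have r0 : 0 < r by rewrite invr_gt0.
rewrite (_ : _ @^-1` _ = \bigcap_(i in [set: 'I_n])
    ((fun t => (f t : 'rV[R]_n) 0 i) @^-1` (ball (c 0 i) r))).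
  apply: fin_bigcap_measurable => [|i _]; first exact: finite_finset.
  rewrite -[X in measurable X]setTI; apply: mf => //.
  exact: measurable_ball.
apply/seteqP; split => t /=.
  by move=> /ball_rowP-/(_ r0) h i _; exact: h.
by move=> h; apply/ball_rowP => // i; exact: h.
Qed.

End borel_maps.

Section mean_width_functional.
Context (R : realType) (d : nat).
Local Notation n := d.+1.
Implicit Types (M K L : set 'rV[R]_n) (x y p u : 'rV[R]_n) (a b r : R).
Local Notation sigma := (@sphere_measure R n).
Local Notation sphere := (@unit_sphere R n : set (borelRn R n)).

Let cube m a b : set 'rV[R]_m := [set x | forall i, a < x 0 i <= b].

Let measurable_cube m a b : measurable (@cube m a b : set (borelRn R m)).
Proof.
rewrite (_ : @cube m a b = \bigcap_(i in [set: 'I_m])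
    ((fun x : 'rV[R]_m => x 0 i) @^-1` `]a, b]%classic)).
  apply: fin_bigcap_measurable => [|i _]; first exact: finite_finset.
  rewrite -[X in measurable X]setTI; apply: (continuous_borelRn_measurable _) => //.
  exact: coord_continuous.
apply/seteqP; split => x /= h i; first by move=> _; rewrite /= in_itv; exact: h.
by have := h i I; rewrite /= in_itv.
Qed.

Let lebesgue_cube m a b : a < b -> lebesgueRn R m (@cube m a b) = ((b - a) ^+ m)%:E.
Proof.
move=> ab; elim: m => [|m IH].
  by rewrite /= diracE mem_set// => -[].
rewrite /= /lebesgue_step /pushforward.
rewrite (_ : _ @^-1` _ = `]a, b]%classic `*` @cube m a b); last first.
  apply/seteqP; split => -[t v] /=.
    move=> h; split; first by have := h 0; rewrite consRnE0 in_itv.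
    by move=> i; have := h (lift 0 i); rewrite !mxE liftK.
  move=> [t0 v0] i; rewrite mxE; case: unliftP => [j|] _ /=; first exact: v0.
  by move: t0; rewrite in_itv.
rewrite product_measure1E//.
rewrite exprS EFinM; congr (_ * _)%E; last exact: IH.
have := @lebesgue_measure_itv R `]a, b]; rewrite /= lte_fin ab -EFinB.
exact.
Qed.

Lemma measurable_unit_sphere : measurable sphere.
Proof.
rewrite (_ : sphere = (@enorm R n) @^-1` [set 1]) //.
rewrite -[X in measurable X]setTI; apply: (continuous_borelRn_measurable _) => //.
exact: continuous_enorm.
Qed.

Let sphere_measureE : sigma sphere =
  (n%:R%:E * lebesgueRn R n [set x : 'rV[R]_n | (0 < enorm x <= 1)%R])%E.
Proof.
rewrite /sphere_measure; congr (_ * lebesgueRn R n _)%E.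
apply/seteqP; split => x /=; first by case.
move=> x01; split => //; have /andP[x0 _] := x01.
by rewrite /unit_sphere/= enormZ ger0_norm ?invr_ge0 ?enorm_ge0// mulVf ?gt_eqF.
Qed.

Let measurable_pball : measurable ([set x : 'rV[R]_n | 0 < enorm x <= 1] : set (borelRn R n)).
Proof.
rewrite (_ : [set _ | _] = (@enorm R n) @^-1` `]0, 1]%classic).
  rewrite -[X in measurable X]setTI; apply: (continuous_borelRn_measurable _) => //.
  exact: continuous_enorm.
by apply/seteqP; split => x /=; rewrite in_itv.
Qed.

(** The punctured unit ball contains a cube of positive volume. *)
Lemma sphere_measure_gt0 : (0 < sigma sphere)%E.
Proof.
rewrite sphere_measureE mule_gt0// ?lte_fin ?ltr0n//.
have n0 : 0 < n%:R :> R by rewrite ltr0n.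
rewrite (@lt_le_trans _ _ (lebesgueRn R n (@cube n 0 n%:R^-1)))//.
  by rewrite lebesgue_cube ?invr_gt0// subr0 lte_fin exprn_gt0// invr_gt0.
apply: le_measure; rewrite ?inE// => x /= h; apply/andP; split.
  rewrite enorm_gt0; apply/eqP => x0; have := h 0.
  by rewrite x0 mxE ltxx.
rewrite (le_trans (enorm_le_sum x))//.
rewrite -(@mulfV _ n%:R) ?gt_eqF// mulr_natl -[X in _ *+ X]card_ord -sumr_const.
by apply: ler_sum => i _; have /andP[i0 i1] := h i; rewrite gtr0_norm.
Qed.

Lemma sphere_measure_lty : (sigma sphere < +oo)%E.
Proof.
rewrite sphere_measureE lte_mul_pinfty ?lee_fin//.
rewrite (@le_lt_trans _ _ (lebesgueRn R n (@cube n (-2) 1)))//; last first.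
  by rewrite lebesgue_cube ?ltry//; lra.
apply: le_measure; rewrite ?inE// => x /= /andP[_ x1] i.
have := le_trans (normr_coord_le x i) x1; rewrite ler_norml; lra.
Qed.

Let fine_sphere : 0 < fine (sigma sphere).
Proof. by rewrite fine_gt0// sphere_measure_gt0 sphere_measure_lty. Qed.

Lemma continuous_sphere_integrable (f : 'rV[R]_n -> R) r : continuous f ->
  (forall u, unit_sphere u -> `|f u| <= r) -> sigma.-integrable sphere (EFin \o f).
Proof.
move=> cf fr; apply: measurable_bounded_integrable.
- exact: measurable_unit_sphere.
- exact: sphere_measure_lty.
- apply: measurable_funTS; exact: continuous_borelRn_measurable.
- exists r; split; first exact: num_real.
  by move=> a ra u Su; apply: le_trans (ltW ra); exact: fr.
Qed.

Lemma support_function_integrable M : convex_body M ->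
  sigma.-integrable sphere (EFin \o support_function M).
Proof.
move=> [M0 cM _]; have [r r0 Mr] := compact_enorm_bounded cM.
apply: (@continuous_sphere_integrable _ r).
  exact: support_function_continuous.
move=> u u1; have s0 : support_function M 0 = 0.
  by rewrite -(scale0r u) support_functionZ// mul0r.
have := support_function_lip u 0 M0 cM Mr; have := support_function_lip 0 u M0 cM Mr.
rewrite sub0r subr0 enormN u1 s0 ler_norml; lra.
Qed.

Lemma mean_width_le M M' : convex_body M -> convex_body M' ->
  (forall u, unit_sphere u -> support_function M u <= support_function M' u) ->
  mean_width M <= mean_width M'.
Proof.
move=> bM bM' MM'; rewrite /mean_width ler_wpM2l ?divr_ge0 ?(ltW fine_sphere)//.
by apply: le_Rintegral => //;
  [exact: measurable_unit_sphere|exact: support_function_integrable..].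
Qed.

Lemma mean_width_sub M M' : convex_body M -> convex_body M' -> M `<=` M' ->
  mean_width M <= mean_width M'.
Proof.
move=> bM bM' MM'; apply: mean_width_le => // u _.
by have [? ? _] := bM; have [_ ? _] := bM'; exact: support_function_mono.
Qed.

Lemma mean_width_minkowski a M b M' : 0 <= a -> 0 <= b ->
  convex_body M -> convex_body M' ->
  mean_width (minkowski a M b M') = a * mean_width M + b * mean_width M'.
Proof.
move=> a0 b0 bM bM'; have [M0 cM _] := bM; have [M'0 cM' _] := bM'.
have mS := measurable_unit_sphere.
have iM := support_function_integrable bM; have iM' := support_function_integrable bM'.
rewrite /mean_width (_ : Rintegral sigma sphere (support_function (minkowski a M b M')) =
    a * Rintegral sigma sphere (support_function M) +
    b * Rintegral sigma sphere (support_function M')); first by ring.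
rewrite -(RintegralZl a mS iM) -(RintegralZl b mS iM') -RintegralD//.
- by apply: eq_Rintegral => u _; exact: support_function_minkowski.
- rewrite (_ : _ \o _ = (fun u => a%:E * (EFin \o support_function M) u)%E)//.
  exact: integrableZl.
- rewrite (_ : _ \o _ = (fun u => b%:E * (EFin \o support_function M') u)%E)//.
  exact: integrableZl.
Qed.

Lemma mean_widthZ a M : 0 <= a -> convex_body M ->
  mean_width (minkowski a M 0 M) = a * mean_width M.
Proof. by move=> a0 bM; rewrite mean_width_minkowski// mul0r addr0. Qed.

Lemma mean_width_eball0 r : 0 <= r -> mean_width (eball (0 : 'rV[R]_n) r) = 2 * r.
Proof.
move=> r0; rewrite /mean_width (@eq_Rintegral _ _ _ _ _ (fun=> r)).
  rewrite (Rintegral_cst sigma measurable_unit_sphere).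
  by rewrite (mulrC r) mulrA divfK// gt_eqF.
move=> u /set_mem u1.
by have := support_function_eball0 (u : 'rV[R]_n) r0; rewrite u1 mulr1.
Qed.

(** A body of the mean width of the ball of radius [r] has a support number at
    most [r]; if its support function oscillates little, it is everywhere at
    most little above [r]. *)
Lemma support_function_le_of_oscillation M r e : convex_body M -> 0 < r ->
  mean_width M = 2 * r ->
  (forall u v, unit_sphere u -> unit_sphere v ->
     support_function M u <= support_function M v + e) ->
  forall u, unit_sphere u -> support_function M u <= r + e.
Proof.
move=> bM r0 Mr osc u Su; rewrite leNgt; apply/negP => ru.
pose t := support_function M u - e.
have rt : r < t by rewrite /t ltrBrDr.
have t0 : 0 <= t by rewrite ltW// (lt_trans r0).
have : mean_width (eball (0 : 'rV[R]_n) t) <= mean_width M.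
  apply: mean_width_le => //; first exact: eball_convex_body.
  move=> v Sv; rewrite support_function_eball0// Sv mulr1 /t lerBlDr.
  exact: osc.
by rewrite mean_width_eball0// Mr ler_pM2l// leNgt rt.
Qed.

End mean_width_functional.

(** * Hyperplanes and their feet *)

Section foot_of_hyperplane.
Context (R : realType) (d : nat).
Local Notation n := d.+1.
Implicit Types (H : hyperplane R n) (K M : set 'rV[R]_n) (x y z u v p : 'rV[R]_n).

(** [p + z] is the orthogonal projection of [p] on [H]. Unlike a pair of a normal
    vector and a level, the foot is determined by the hyperplane, and a
    hyperplane missing [p] is determined by its foot. *)
Definition is_foot p H z :=
  points H (p + z) /\ (forall x, points H x -> dot (x - p) z = dot z z).

Lemma is_foot_hplane p H u t : u != 0 -> points H = hplane u t ->
  is_foot p H (((t - dot p u) / dot u u) *: u).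
Proof.
move=> u0 Hut; rewrite /is_foot Hut; have uu : dot u u != 0 by rewrite dotxx_eq0.
split; first by rewrite /hplane/= dotDl dotZl divfK// addrC subrK.
by move=> x xt; rewrite !dotZr dotZl dotBl xt divfK.
Qed.

Lemma is_foot_unique p H z z' : is_foot p H z -> is_foot p H z' -> z = z'.
Proof.
move=> [Hz zz] [Hz' z'z']; apply/eqP; rewrite -subr_eq0 -dotxx_eq0; apply/eqP.
have pK q : p + q - p = q by rewrite addrAC subrr add0r.
have := zz _ Hz'; have := z'z' _ Hz; rewrite !pK => h1 h2.
by rewrite dotBl !dotBr h1 h2 !subrr.
Qed.

Lemma exists_foot p H : exists z, is_foot p H z.
Proof.
have [u [t [u0 Hut]]] := pointsP H.
by exists (((t - dot p u) / dot u u) *: u); exact: is_foot_hplane.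
Qed.

Definition foot p H : 'rV[R]_n := sval (cid (exists_foot p H)).

Lemma footP p H : is_foot p H (foot p H).
Proof. exact: svalP (cid (exists_foot p H)). Qed.

Lemma foot_hplane p H u t : u != 0 -> points H = hplane u t ->
  foot p H = ((t - dot p u) / dot u u) *: u.
Proof. by move=> u0 Hut; apply: is_foot_unique (footP p H) (is_foot_hplane p u0 Hut). Qed.

Lemma foot_eq0 p H : (foot p H = 0) <-> points H p.
Proof.
have [h1 h2] := footP p H; split=> [f0|Hp]; first by move: h1; rewrite f0 addr0.
by apply/eqP; rewrite -dotxx_eq0 -(h2 _ Hp) subrr dot0l.
Qed.

Lemma points_foot p H x : foot p H != 0 ->
  points H x <-> dot (x - p) (foot p H) = dot (foot p H) (foot p H).
Proof.
move=> f0; split; first by move=> Hx; exact: (footP p H).2.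
have [u [t [u0 Hut]]] := pointsP H; move: f0; rewrite (foot_hplane p u0 Hut) Hut.
have uu : dot u u != 0 by rewrite dotxx_eq0.
rewrite scaler_eq0 negb_or u0 andbT => c0; rewrite !dotZr dotZl.
by move=> /(mulfI c0); rewrite divfK// dotBl => /addIr.
Qed.

Lemma hplane_hyperplane u t : u != 0 -> exists H, points H = hplane u t.
Proof.
move=> u0; have h : exists v s, v != 0 /\ hplane u t = hplane v s by exists u, t.
by exists (Hyperplane h).
Qed.

(** The topology on hyperplanes is the quotient topology of the parameters
    [(u, t)], and the foot is a continuous function of these as long as
    [u != 0]. *)
Lemma measurable_foot p :
  measurable_fun [set: borelH R d] (foot p : borelH R d -> borelRn R n).
Proof.
apply: measurable_fun_borelRn => B oB; apply: sub_sigma_algebra.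
pose phi (q : 'rV[R]_n * R) := ((q.2 - dot p q.1) / dot q.1 q.1) *: q.1.
have oE : open [set q : 'rV[R]_n * R | q.1 != 0].
  rewrite (_ : [set _ | _] = fst @^-1` (~` [set (0 : 'rV[R]_n)])).
    apply: open_comp; first by move=> q _; exact: cvg_fst.
    apply: closed_openC; apply: accessible_closed_set1.
    by apply: hausdorff_accessible; exact: norm_hausdorff.
  by apply/seteqP; split=> -[u t] /= /eqP.
have cd (q : 'rV[R]_n * R) : {for q, continuous (fun q : 'rV[R]_n * R => dot q.1 q.1)}.
  rewrite (_ : (fun _ => _) = (fun r : R => r ^+ 2) \o (@enorm R n) \o fst).
    apply: continuous_comp; first exact: cvg_fst.
    apply: continuous_comp; first exact: continuous_enorm.
    exact: exprn_continuous.
  by apply/funext => q' /=; rewrite sqr_enorm.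
have cphi (q : 'rV[R]_n * R) : q.1 != 0 -> {for q, continuous phi}.
  move=> q0.
  apply: (@continuousZ _ _ _ (fun q : 'rV[R]_n * R => (q.2 - dot p q.1) / dot q.1 q.1) fst); last exact: cvg_fst.
  apply: (@continuousM _ _ (fun q : 'rV[R]_n * R => q.2 - dot p q.1)); last first.
    by apply: continuousV; [rewrite dotxx_eq0|exact: cd].
  apply: continuousB; first exact: cvg_snd.
  rewrite (_ : (fun _ => _) = (fun y => dot y p) \o fst).
    by apply: continuous_comp; [exact: cvg_fst|exact: continuous_dotl].
  by apply/funext => q'; rewrite /= dotC.
change (open [set q : 'rV[R]_n * R |
    q.1 != 0 /\ exists2 H, (foot p @^-1` B) H & points H = hplane q.1 q.2]).
rewrite (_ : [set _ | _] = [set q | q.1 != 0] `&` phi @^-1` B).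
  rewrite openE => q [q0 Bq]; apply: filterI; first exact: open_nbhs_nbhs.
  exact: (cphi _ q0) (open_nbhs_nbhs (conj oB Bq)).
apply/seteqP; split => q /=.
  by move=> [q0 [H BH Hq]]; split => //; move: BH; rewrite /= (foot_hplane p q0 Hq).
move=> [q0 Bq]; split => //; have [H Hq] := hplane_hyperplane q.2 q0.
by exists H => //=; rewrite (foot_hplane p q0 Hq).
Qed.

(** On the segment from the pivot to a point of the body that is extreme in the
    direction of the foot, the scalar product with the foot takes all values
    between zero and its maximum; so [H] is hit exactly when its level is one
    of them. *)
Lemma hitE M p H : convex_body M -> M p ->
  hit M H <-> dot (foot p H) (foot p H) <= support_function M (foot p H) - dot p (foot p H).
Proof.
move=> bM Mp; have /convex_bodyP[M0 cM vM] := bM.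
have [h1 h2] := footP p H; set z := foot p H in h1 h2 *; split.
  by move=> [x [/h2 <- Mx]]; rewrite dotBl lerD2r support_function_ge.
have [z0 _|z0] := eqVneq z 0.
  by exists p; split => //; move: h1; rewrite z0 addr0.
have [x Mx [-> _]] := support_function_attained z M0 cM.
rewrite -dotBl => zm.
have z2 : 0 < dot z z by rewrite lt0r dotxx_eq0 z0 dotxx_ge0.
have m0 := lt_le_trans z2 zm.
pose l := dot z z / dot (x - p) z.
exists (l *: x + (1 - l) *: p); split; last first.
  apply: vM => //; rewrite divr_ge0 ?(ltW z2) ?(ltW m0)//=.
  by rewrite ler_pdivrMr// mul1r.
apply/(points_foot _ z0).
rewrite (_ : _ - p = l *: (x - p)); last first.
  by rewrite scalerBl scale1r scalerBr addrA addrAC addrK.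
by rewrite dotZl divfK// gt_eqF.
Qed.

(** As for [hitE]; the inequality becomes strict because the segment from an
    interior point to a point of the body is interior except possibly for its
    end. *)
Lemma hit_interiorE K p H : convex_body K -> K° p -> foot p H != 0 ->
  hit K° H <-> dot (foot p H) (foot p H) < support_function K (foot p H) - dot p (foot p H).
Proof.
move=> bK Kp z0; have /convex_bodyP[K0 cK vK] := bK.
have [h1 h2] := footP p H; set z := foot p H in h1 h2 z0 *.
have z2 : 0 < dot z z by rewrite lt0r dotxx_eq0 z0 dotxx_ge0.
have ez : 0 < enorm z by rewrite enorm_gt0.
split.
  move=> [x [/h2 xz /interior_eball[r r0 rK]]].
  have Kx : K (x + (r / enorm z) *: z).
    apply: rK; rewrite /eball/= addrAC subrr add0r enormZ.
    by rewrite ger0_norm ?divr_ge0 ?(ltW r0) ?(ltW ez)// divfK// gt_eqF.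
  have := support_function_ge z cK Kx; rewrite dotDl dotZl.
  have : 0 < r / enorm z * dot z z by rewrite mulr_gt0// divr_gt0.
  move: xz; rewrite dotBl; lra.
have [x Kx [-> _]] := support_function_attained z K0 cK.
rewrite -dotBl => zm.
have m0 := lt_trans z2 zm.
pose l := dot z z / dot (x - p) z.
have l0 : 0 <= l by rewrite divr_ge0 ?(ltW z2) ?(ltW m0).
have l1 : 0 < 1 - l by rewrite subr_gt0 ltr_pdivrMr// mul1r.
exists (l *: x + (1 - l) *: p); split.
  apply/(points_foot _ z0).
  rewrite (_ : _ - p = l *: (x - p)); last first.
    by rewrite scalerBl scale1r scalerBr addrA addrAC addrK.
  by rewrite dotZl divfK// gt_eqF.
have [r r0 rK] := interior_eball Kp.
apply: (@eball_interior _ _ _ _ ((1 - l) * r)); first by rewrite mulr_gt0.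
move=> y yr.
have -> : y = l *: x + (1 - l) *: ((1 - l)^-1 *: (y - l *: x)).
  by rewrite scalerA divff ?gt_eqF// scale1r addrC subrK.
apply: vK => //; first by rewrite l0 -subr_ge0 ltW.
apply: rK; rewrite /eball/= -(@ler_pM2l _ (1 - l))//.
rewrite -[X in X * enorm _]gtr0_norm// -enormZ scalerBr scalerA divff ?gt_eqF//.
by rewrite scale1r -addrA -opprD.
Qed.

Lemma near_hyperplanesE K p H : convex_body K -> K° p ->
  near_hyperplanes K H <-> foot p H != 0 /\
    0 <= dot (foot p H) (foot p H) - (support_function K (foot p H) - dot p (foot p H))
      <= enorm (foot p H).
Proof.
move=> bK Kp; have Kp' : K p by exact: interior_subset Kp.
have bK1 := parallel_body_convex_body bK.
have h1 := hitE H bK1 (sub_parallel_body Kp').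
rewrite support_function_parallel_body// in h1.
have [z0|z0] := eqVneq (foot p H) 0.
  split=> [[_ []]|[]//].
  by exists p; split => //; exact/(foot_eq0 p H).
have h2 := hit_interiorE bK Kp z0.
split.
  move=> [/h1 k1 /h2/negP]; rewrite -leNgt => k2; split => //.
  by apply/andP; split; move: k1 k2; lra.
move=> [_ /andP[k1 k2]]; split; first by apply/h1; move: k2; lra.
by move/h2; apply/negP; rewrite -leNgt; move: k1; lra.
Qed.

(** A halfspace bounded by [H] and containing the interior point [p] has its
    outer normal in the direction of the foot, so there is only one. *)
Lemma HminusE K p H : convex_body K -> K° p -> near_hyperplanes K H ->
  Hminus K H = [set x | dot (x - p) (foot p H) <= dot (foot p H) (foot p H)].
Proof.
move=> bK Kp /(near_hyperplanesE _ bK Kp) [z0 /andP[k1 _]].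
have Kp' : K p by exact: interior_subset Kp.
have [_ cK _] := bK.
set z := foot p H in z0 k1 *.
apply/seteqP; split => x.
  move=> /(_ [set x | dot (x - p) z <= dot z z]); apply; split.
    exists z, (dot z z + dot p z); split => //.
      apply/seteqP; split => y; rewrite /hplane/=.
        by move=> /(points_foot y z0); rewrite dotBl => /eqP; rewrite subr_eq => /eqP.
      by move=> h; apply/(points_foot y z0); rewrite dotBl h addrK.
    by apply/seteqP; split => y /=; rewrite dotBl lerBlDr.
  move=> y Ky /=; rewrite dotBl.
  by have := support_function_ge z cK Ky; move: k1; lra.
move=> /= xz _ [[u [t [u0 Hut ->]]] KG] /=.
have uu : 0 < dot u u by rewrite lt0r dotxx_eq0 u0 dotxx_ge0.
have pt : dot p u <= t by exact: KG.
move: xz z0; rewrite /z (foot_hplane p u0 Hut) scaler_eq0 negb_or => + /andP[c0 _].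
rewrite !dotZr dotZl divfK ?gt_eqF// dotBl.
have {}c0 : 0 < (t - dot p u) / dot u u.
  by rewrite lt0r c0 divr_ge0 ?subr_ge0// ltW.
by rewrite ler_pM2l// lerD2r.
Qed.

Lemma foot_move Q b p H H' : orthogonal_mx Q -> points H' = move Q b @` points H ->
  foot (move Q b p) H' = foot p H *m Q.
Proof.
move=> oQ H'H; apply: is_foot_unique (footP (move Q b p) H') _.
have [h1 h2] := footP p H; rewrite /is_foot H'H; split.
  by exists (p + foot p H) => //; rewrite /move mulmxDl addrAC.
move=> _ [x Hx <-]; rewrite orthogonal_dot// -(h2 _ Hx) -[RHS](orthogonal_dot _ _ oQ).
by rewrite /move opprD addrACA subrr addr0 mulmxBl.
Qed.

End foot_of_hyperplane.

(** * Averaging over rotations *)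

Section image_measures.
Context d1 d2 (X : measurableType d1) (Y : measurableType d2) (R : realType).
Variables (phi : X -> Y) (mphi : measurable_fun setT phi).
Variable m : {measure set X -> \bar R}.

Definition image_measure : {measure set Y -> \bar R}.
Proof. by refine (pushforward m phi); exact: mphi. Defined.

Lemma image_measureE A : image_measure A = m (phi @^-1` A).
Proof. by []. Qed.

(** Change of variables for a measure [m'] that is only known to agree with the
    image measure on measurable sets. *)
Lemma ge0_integral_image (m' : {measure set Y -> \bar R}) D (f : Y -> \bar R) :
  (forall A, measurable A -> m' A = m (phi @^-1` A)) ->
  measurable D -> measurable_fun D f -> (forall y, D y -> 0 <= f y)%E ->
  (\int[m']_(y in D) f y = \int[m]_(x in phi @^-1` D) f (phi x))%E.
Proof.
move=> m'E mD mf f0; rewrite (@eq_measure_integral _ _ _ _ image_measure) => [|A mA _].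
  by rewrite ge0_integral_pushforward// => y /set_mem; exact: f0.
exact: m'E.
Qed.

End image_measures.

Section averaging.
Context (R : realType) (d : nat) (hd : (2 <= d.+1)%N).
Local Notation n := d.+1.
Implicit Types (u v : 'rV[R]_n) (g : 'rV[R]_n -> R) (Q : 'M[R]_n) (a e r : R).
Local Notation sphere := (@unit_sphere R n).

Lemma unit_sphere_inhabited : exists u : 'rV[R]_n, sphere u.
Proof.
have [u u1 _] := @exists_orthogonal_unit R n 0 hd.
by exists u.
Qed.

Lemma unit_sphere_net e : 0 < e ->
  exists s : seq 'rV[R]_n, (forall v, v \in s -> sphere v) /\
    (forall u, sphere u -> exists2 v, v \in s & enorm (u - v) < e).
Proof.
move=> e0.
have cS := @compact_unit_sphere R n.
move: cS; rewrite compact_cover => /(_ 'rV[R]_n sphere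
  (fun v => [set u | enorm (u - v) < e])) [].
- move=> v _; apply: (@open_comp _ _ (fun u => enorm (u - v)) [set t | t < e]); last exact: open_lt.
  move=> x _; apply: continuous_comp; last exact: continuous_enorm.
  by apply: (@continuousB _ _ _ id (cst v)); [exact: cvg_id|exact: cst_continuous].
- by move=> u Su; exists u => //=; rewrite subrr enorm0.
move=> D DS SD; exists (finmap.enum_fset D); split=> [v vD|u Su].
  by have /DS/set_mem := vD.
by have [v vD uv] := SD u Su; exists v.
Qed.

Variables (G : set ('rV[R]_n -> R)) (L : R).
Hypothesis G_lip : forall g u v, G g -> sphere u -> sphere v ->
  g u - g v <= L * enorm (u - v).
Hypothesis G_rot : forall g Q, G g -> rotation Q -> G (fun u => g (u *m Q)).
Hypothesis G_half : forall g g', G g -> G g' -> G (fun u => 2^-1 * g u + 2^-1 * g' u).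

Let sphere_rot Q u : rotation Q -> sphere u -> sphere (u *m Q).
Proof. by move=> [oQ _] Su; rewrite /unit_sphere/= orthogonal_enorm. Qed.

(** If [g] is at most [M - c] on a cap, rotations carry that cap over any given
    finite family of caps, and averaging spreads the gain over their union; the
    gain depends on [c] and the number of caps only. *)
Let spread_gain (s : seq 'rV[R]_n) r c : (forall v, v \in s -> sphere v) -> 0 < c ->
  exists2 c', 0 < c' & forall g M v0, G g -> sphere v0 ->
  (forall u, sphere u -> g u <= M) ->
  (forall u, sphere u -> enorm (u - v0) < r -> g u <= M - c) ->
  exists g', [/\ G g', (forall u, sphere u -> g' u <= M),
    (forall u v, sphere u -> v \in s -> enorm (u - v) < r -> g' u <= M - c') &
    (forall m, (forall u, sphere u -> m <= g u) -> (forall u, sphere u -> m <= g' u))].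
Proof.
elim: s => [_|v s IH sS] c0.
  by exists 1 => // g M v0 Gg Sv0 gM _; exists g; split.
have [w ws|c1 c10 {}IH] := IH _ c0; first by apply: sS; rewrite inE ws orbT.
exists (2^-1 * Num.min c c1); first by rewrite mulr_gt0// lt_min c0 c10.
move=> g M v0 Gg Sv0 gM gMc.
have [g1 [Gg1 g1M g1Mc g1m]] := IH g M v0 Gg Sv0 gM gMc.
have [Q rQ vQ] := exists_rotation hd (sS _ (mem_head v s)) Sv0.
exists (fun u => 2^-1 * g (u *m Q) + 2^-1 * g1 u); split.
- by apply: G_half => //; exact: G_rot.
- move=> u Su; have := gM _ (sphere_rot rQ Su); have := g1M _ Su; lra.
- move=> u w Su; rewrite inE => /orP[/eqP ->|ws] uw.
    have : Num.min c c1 <= c by rewrite ge_min lexx.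
    have : g (u *m Q) <= M - c.
      apply: gMc; first exact: sphere_rot.
      by rewrite -vQ -mulmxBl orthogonal_enorm//; have [] := rQ.
    have := g1M _ Su; lra.
  have : Num.min c c1 <= c1 by rewrite ge_min lexx orbT.
  have := gM _ (sphere_rot rQ Su); have := g1Mc _ _ Su ws uw; lra.
- move=> m gm u Su; have := gm _ (sphere_rot rQ Su); have := g1m m gm _ Su; lra.
Qed.

(** Averages of rotated copies have arbitrarily small oscillation: as long as
    the oscillation exceeds [e], the function is well below its maximum on a
    cap whose radius is controlled by the Lipschitz constant, and
    [spread_gain] lowers the maximum by a fixed amount while the minimum does
    not decrease. *)
Lemma averaging e : 0 < e -> G !=set0 ->
  exists2 g, G g & forall u v, sphere u -> sphere v -> g u <= g v + e.
Proof.
move=> e0 [g0 Gg0].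
have [u0 Su0] := unit_sphere_inhabited.
pose L' := `|L| + 1.
have L'0 : 0 < L' by rewrite ltr_wpDl.
have lip g u v : G g -> sphere u -> sphere v -> g u - g v <= L' * enorm (u - v).
  move=> Gg Su Sv; apply: (le_trans (G_lip Gg Su Sv)).
  by rewrite ler_wpM2r ?enorm_ge0// (le_trans (ler_norm L))// lerDl.
pose r := e / 2 / L'.
have r0 : 0 < r by rewrite !divr_gt0.
have [s [sS Ss]] := unit_sphere_net r0.
have [c c0 hc] := @spread_gain s r (e / 2) sS (divr_gt0 e0 (ltr0Sn _ _)).
suff H k : forall g m M, G g -> (forall u, sphere u -> m <= g u <= M) ->
    M - m <= k%:R * c + e ->
    exists2 g, G g & forall u v, sphere u -> sphere v -> g u <= g v + e.
  pose m := g0 u0 - L' * 2; pose M := g0 u0 + L' * 2.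
  apply: (H (Num.truncn ((M - m) / c)).+1 g0 m M Gg0) => [u Su|].
    have uu0 : enorm (u - u0) <= 2.
      by rewrite (le_trans (ler_enormD _ _))// enormN Su Su0.
    have := ler_wpM2l (ltW L'0) uu0.
    have := lip _ _ _ Gg0 Su Su0; have := lip _ _ _ Gg0 Su0 Su.
    rewrite (enorm_distC u0) /m /M; lra.
  rewrite (@le_trans _ _ ((Num.truncn ((M - m) / c)).+1%:R * c))//.
    by rewrite -ler_pdivrMr// ltW// truncnS_gt.
  by rewrite lerDl ltW.
elim: k => [|k IH] g m M Gg gmM Mm.
  exists g => // u v Su Sv; have := gmM _ Su; have := gmM _ Sv; move: Mm.
  rewrite mul0r; lra.
have [osc|] := pselect (forall u v, sphere u -> sphere v -> g u <= g v + e).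
  by exists g.
move=> /existsNP[u1 /existsNP[v1 /not_implyP[Su1 /not_implyP[Sv1]]]].
move=> /negP; rewrite -ltNge => osc.
have cap u : sphere u -> enorm (u - v1) < r -> g u <= M - e / 2.
  move=> Su uv1; have := lip _ _ _ Gg Su Sv1; have /andP[_] := gmM _ Su1.
  have : L' * enorm (u - v1) <= e / 2 by rewrite mulrC -ler_pdivlMr// ltW.
  move: osc; lra.
have gM u : sphere u -> g u <= M by move=> /gmM/andP[].
have [g' [Gg' g'M g'c g'm]] := hc g M v1 Gg Sv1 gM cap.
apply: (IH g' m (M - c) Gg') => [u Su|]; last by move: Mm; rewrite -natr1 mulrDl; lra.
apply/andP; split; first by apply: g'm => // v Sv; have /andP[] := gmM _ Sv.
by have [v vs uv] := Ss _ Su; exact: g'c uv.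
Qed.

End averaging.

(** * Uniqueness of rotation invariant measures on the sphere *)

Section rotation_invariant_measures.
Context (R : realType) (d : nat) (hd : (2 <= d.+1)%N).
Local Notation n := d.+1.
Implicit Types (u v x y : 'rV[R]_n) (g : 'rV[R]_n -> R) (Q : 'M[R]_n) (L e : R).
Local Notation sphere := (@unit_sphere R n : set (borelRn R n)).

Definition rotation_invariant (m : set (borelRn R n) -> \bar R) :=
  forall Q (A : set (borelRn R n)), rotation Q -> measurable A ->
    m ((mulmx^~ Q : 'rV[R]_n -> 'rV[R]_n) @^-1` A) = m A.

Lemma measurable_mulmx Q : orthogonal_mx Q ->
  measurable_fun [set: borelRn R n] (mulmx^~ Q : borelRn R n -> borelRn R n).
Proof.
move=> oQ; apply: measurable_continuousRn.
rewrite (_ : mulmx^~ Q = move Q 0); first exact: continuous_move.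
by apply/funext => x; rewrite /move addr0.
Qed.

Let lipschitz L g := forall u v, g u - g v <= L * enorm (u - v).

Section one_measure.
Variable m : {measure set (borelRn R n) -> \bar R}.
Hypothesis m_fin : (m setT < +oo)%E.
Hypothesis m_rot : rotation_invariant m.

Let m_sphere : (m sphere < +oo)%E.
Proof.
apply: le_lt_trans m_fin; apply: le_measure; rewrite ?inE//.
exact: measurable_unit_sphere.
Qed.

Lemma lipschitz_integrable L g : lipschitz L g -> m.-integrable sphere (EFin \o g).
Proof.
move=> lg.
have gL (u : 'rV[R]_n) : enorm u = 1 -> `|g u| <= `|g 0| + `|L|.
  move=> u1; have := lg u 0; have := lg 0 u; rewrite sub0r subr0 enormN u1.
  have := ler_norm L; have := ler_norm (- g 0); have := ler_norm (g 0).
  rewrite normrN [in X in _ -> _ -> _ -> _ -> _ -> X]ler_norml; lra.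
apply: measurable_bounded_integrable.
- exact: measurable_unit_sphere.
- exact: m_sphere.
- apply: measurable_funTS; apply: continuous_borelRn_measurable.
  exact: enorm_lip_continuous lg.
- exists (`|g 0| + `|L|); split; first exact: num_real.
  by move=> a ga u Su; apply: le_trans (ltW ga); exact: gL.
Qed.

Lemma Rintegral_rotation L g Q : lipschitz L g -> rotation Q ->
  Rintegral m sphere (fun u : 'rV[R]_n => g (u *m Q)) = Rintegral m sphere g.
Proof.
move=> lg rQ; have [oQ _] := rQ; have mQ := measurable_mulmx oQ.
have SQ : (mulmx^~ Q : 'rV[R]_n -> 'rV[R]_n) @^-1` sphere = sphere.
  by apply/seteqP; split => u; rewrite /unit_sphere/= orthogonal_enorm.
rewrite /Rintegral; congr fine; apply/esym.
rewrite (@eq_measure_integral _ _ _ _ (image_measure mQ m)) => [|A mA _]; last first.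
  by rewrite image_measureE m_rot.
rewrite (integral_pushforward mQ) ?SQ//.
- apply/measurable_EFinP; apply: continuous_borelRn_measurable.
  exact: enorm_lip_continuous lg.
- rewrite (_ : _ \o _ = EFin \o (fun u : 'rV[R]_n => g (u *m Q)))//.
  by apply: (@lipschitz_integrable L) => u v; rewrite -(orthogonal_enorm _ oQ) mulmxBl.
- exact: measurable_unit_sphere.
Qed.

Lemma Rintegral_half L g g' : lipschitz L g -> lipschitz L g' ->
  Rintegral m sphere (fun u => 2^-1 * g u + 2^-1 * g' u) =
  2^-1 * Rintegral m sphere g + 2^-1 * Rintegral m sphere g'.
Proof.
move=> lg lg'; have mS := @measurable_unit_sphere R d.
have ig := lipschitz_integrable lg; have ig' := lipschitz_integrable lg'.
rewrite -(RintegralZl _ mS ig) -(RintegralZl _ mS ig') -RintegralD//.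
  rewrite (_ : _ \o _ = (fun u => 2^-1%:E * (EFin \o g) u)%E)//.
  exact: integrableZl.
rewrite (_ : _ \o _ = (fun u => 2^-1%:E * (EFin \o g') u)%E)//.
exact: integrableZl.
Qed.

Lemma Rintegral_bounds L g a b : lipschitz L g ->
  (forall u, unit_sphere u -> a <= g u <= b) ->
  a * fine (m sphere) <= Rintegral m sphere g <= b * fine (m sphere).
Proof.
move=> lg gab; have mS := @measurable_unit_sphere R d.
have ic c : m.-integrable sphere (EFin \o (fun=> c)).
  by apply: (@lipschitz_integrable 0) => u v; rewrite subrr mul0r.
rewrite -!(Rintegral_cst m mS); apply/andP; split; apply: le_Rintegral => //.
- exact: lipschitz_integrable lg.
- by move=> u /gab /andP[].
- exact: lipschitz_integrable lg.
- by move=> u /gab /andP[].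
Qed.

End one_measure.

Variables m1 m2 : {measure set (borelRn R n) -> \bar R}.
Hypothesis m1_fin : (m1 setT < +oo)%E.
Hypothesis m12 : m1 setT = m2 setT.
Hypothesis m1_sphere : m1 (~` sphere) = 0%E.
Hypothesis m2_sphere : m2 (~` sphere) = 0%E.
Hypothesis m1_rot : rotation_invariant m1.
Hypothesis m2_rot : rotation_invariant m2.

Let on_sphere (m : {measure set (borelRn R n) -> \bar R}) (A : set (borelRn R n)) :
  m (~` sphere) = 0%E -> measurable A -> m A = m (A `&` sphere).
Proof.
move=> m0 mA; have mS := @measurable_unit_sphere R d.
have mAS : measurable (A `&` sphere) by exact: measurableI.
have mAD : measurable (A `\` sphere) by exact: measurableD.
have AD0 : m (A `\` sphere) = 0%E.
  apply: (@subset_measure0 _ _ _ m _ (~` sphere)) => //; exact: measurableC.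
have disj : (A `&` sphere) `&` (A `\` sphere) = set0.
  by apply/seteqP; split => // u [[_ ?] [_ ?]].
by have := measureU m mAS mAD disj; rewrite setUIDK [X in _ = (_ + X)%E]AD0 adde0.
Qed.

Let m2_fin : (m2 setT < +oo)%E. Proof. by rewrite -m12. Qed.

Let m12_sphere : m1 sphere = m2 sphere.
Proof. by have := m12; rewrite (on_sphere m1_sphere)// (on_sphere m2_sphere)// !setTI. Qed.

(** A Lipschitz function has the same integral as the averages of its rotated
    copies, which are nearly constant by [averaging]; so both integrals are
    nearly that constant times the common total mass. *)
Lemma Rintegral_rotation_invariant L g : lipschitz L g ->
  Rintegral m1 sphere g = Rintegral m2 sphere g.
Proof.
move=> lg.
pose G : set ('rV[R]_n -> R) := [set f | [/\ lipschitz L f,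
  Rintegral m1 sphere f = Rintegral m1 sphere g &
  Rintegral m2 sphere f = Rintegral m2 sphere g]].
have Glip f u v : G f -> unit_sphere u -> unit_sphere v -> f u - f v <= L * enorm (u - v).
  by move=> [lf _ _] _ _; exact: lf.
have Grot f Q : G f -> rotation Q -> G (fun u => f (u *m Q)).
  move=> [lf f1 f2] rQ; have [oQ _] := rQ; split.
  - by move=> u v; rewrite -(orthogonal_enorm (u - v) oQ) mulmxBl.
  - by rewrite -f1; exact: Rintegral_rotation lf rQ.
  - by rewrite -f2; exact: Rintegral_rotation lf rQ.
have Ghalf f f' : G f -> G f' -> G (fun u => 2^-1 * f u + 2^-1 * f' u).
  move=> [lf f1 f2] [lf' f'1 f'2]; split.
  - by move=> u v; have := lf u v; have := lf' u v; lra.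
  - by rewrite (Rintegral_half m1_fin lf lf') f1 f'1; lra.
  - by rewrite (Rintegral_half m2_fin lf lf') f2 f'2; lra.
pose T := fine (m1 sphere).
have T0 : 0 <= T by rewrite fine_ge0.
have close e : 0 < e -> `|Rintegral m1 sphere g - Rintegral m2 sphere g| <= e * T.
  move=> e0.
  have [|f [lf <- <-] osc] := averaging hd Glip Grot Ghalf e0; first by exists g.
  have [u0 Su0] := unit_sphere_inhabited R hd.
  have fb u : unit_sphere u -> f u0 - e <= f u <= f u0 + e.
    by move=> Su; have := osc _ _ Su Su0; have := osc _ _ Su0 Su; lra.
  pose a := inf (f @` @unit_sphere R n).
  have lb : has_lbound (f @` @unit_sphere R n).
    by exists (f u0 - e) => _ [u /fb/andP[? _] <-].
  have fa u : unit_sphere u -> a <= f u <= a + e.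
    move=> Su; rewrite ge_inf//=; last by exists u.
    rewrite -lerBlDr; apply: lb_le_inf; first by exists (f u0), u0.
    by move=> _ [v Sv <-]; rewrite lerBlDr; exact: osc.
  have := Rintegral_bounds m1_fin lf fa; have := Rintegral_bounds m2_fin lf fa.
  rewrite -m12_sphere -/T ler_norml mulrDl; lra.
apply/eqP; rewrite -subr_eq0 -normr_le0; apply/ler_addgt0Pr => e e0.
rewrite add0r; apply: le_trans (close (e / (T + 1)) _) _.
  by rewrite divr_gt0// ltr_wpDl.
by rewrite -mulrA ler_piMr ?(ltW e0)// mulrC ler_pdivrMr ?mul1r ?lerDl// ltr_wpDl.
Qed.

(** Lipschitz functions increasing to the indicator function of the open set [U]:
    the distance to the complement, multiplied by [k] and truncated at one. *)
Let bump (U : set 'rV[R]_n) (k : nat) x : R :=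
  inf [set Num.min 1 (k%:R * `|x - y|) | y in ~` U].

Let bump_lb U k x : has_lbound [set Num.min (1 : R) (k%:R * `|x - y|) | y in ~` U].
Proof. by exists 0 => _ [y _ <-]; rewrite le_min ler01 mulr_ge0. Qed.

Let bump_lip U k : ~` U !=set0 -> lipschitz k%:R (bump U k).
Proof.
move=> U0 u v; rewrite lerBlDr addrC -lerBlDr; apply: lb_le_inf.
  by have [y Uy] := U0; exists (Num.min 1 (k%:R * `|v - y|)), y.
move=> _ [y Uy <-]; rewrite lerBlDr.
apply: (@le_trans _ _ (Num.min 1 (k%:R * `|u - y|))); first by apply: ge_inf => //; exists y.
have kuv : k%:R * `|u - y| <= k%:R * `|v - y| + k%:R * enorm (u - v).
  rewrite -mulrDr ler_wpM2l// [leRHS]addrC.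
  apply: le_trans (lerD (normr_le_enorm _) (lexx _)).
  exact: ler_distD.
have ke : 0 <= k%:R * enorm (u - v) by rewrite mulr_ge0 ?enorm_ge0.
rewrite ge_min; case: (leP 1 (k%:R * `|v - y|)) => _; first by rewrite lerDl ke.
by rewrite kuv orbT.
Qed.

Let bump_ge0 U k x : ~` U !=set0 -> 0 <= bump U k x.
Proof.
move=> [y Uy]; apply: lb_le_inf; first by exists (Num.min 1 (k%:R * `|x - y|)), y.
by move=> _ [z _ <-]; rewrite le_min ler01 mulr_ge0.
Qed.

Let bump_nd U x k l : ~` U !=set0 -> (k <= l)%N -> bump U k x <= bump U l x.
Proof.
move=> [y Uy] kl; apply: lb_le_inf; first by exists (Num.min 1 (l%:R * `|x - y|)), y.
move=> _ [z Uz <-]; apply: (@le_trans _ _ (Num.min 1 (k%:R * `|x - z|))).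
  by apply: ge_inf => //; exists z.
by rewrite le_min !ge_min lexx/= ler_wpM2r ?ler_nat ?orbT.
Qed.

Let bump_lim U x : open U -> ~` U !=set0 ->
  limn (fun k => (bump U k x)%:E) = (\1_U x)%:E :> \bar R.
Proof.
move=> oU U0; apply: cvg_lim => //; rewrite indicE.
case: (boolP (x \in U)) => [/set_mem Ux|/negP Ux]; last first.
  rewrite (_ : (fun _ => _) = cst 0%E); first exact: cvg_cst.
  apply/funext => k; congr EFin; apply/eqP; rewrite eq_le bump_ge0// andbT.
  apply: ge_inf => //; exists x; first by move=> Ux'; apply: Ux; exact: mem_set.
  by rewrite subrr normr0 mulr0; apply/min_idPr.
have /nbhs_ballP[r /= r0 rU] := open_nbhs_nbhs (conj oU Ux).
apply: cvg_near_cst; exists (Num.truncn r^-1).+1 => // k /= rk.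
congr EFin; apply/eqP; rewrite eq_le; apply/andP; split.
  have [y Uy] := U0; apply: (@le_trans _ _ (Num.min 1 (k%:R * `|x - y|))).
    by apply: ge_inf => //; exists y.
  by rewrite ge_min lexx.
apply: lb_le_inf; first by have [y Uy] := U0; exists (Num.min 1 (k%:R * `|x - y|)), y.
move=> _ [y Uy <-]; rewrite le_min lexx/=.
have xy : r <= `|x - y|.
  by rewrite leNgt; apply/negP => xy; apply: Uy; apply: rU; rewrite -ball_normE.
rewrite -[leLHS](@mulVf _ r) ?gt_eqF// ler_pM ?invr_ge0 ?(ltW r0)//.
apply/ltW/(lt_le_trans (truncnS_gt _)). by rewrite ler_nat.
Qed.

(** Equality of the integrals of Lipschitz functions passes to open sets by
    monotone convergence along [bump], and from there to Borel sets. *)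
Theorem rotation_invariant_measure_unique (A : set (borelRn R n)) :
  measurable A -> m1 A = m2 A.
Proof.
have mS := @measurable_unit_sphere R d.
apply: (@measure_unique _ R (borelRn R n) (@open 'rV[R]_n) (fun=> setT)) => //.
- by move=> U V; exact: openI.
- by move=> _; exact: openT.
- by apply/seteqP; split => // x _; exists 0%N.
move=> U oU; have mU := open_measurableRn oU.
have [U0|/set0P U0] := eqVneq (~` U) set0.
  by rewrite (_ : U = setT)// -(setCK U) U0 setC0.
have cb k : continuous (bump U k) by exact: enorm_lip_continuous (bump_lip k U0).
have key (m : {measure set (borelRn R n) -> \bar R}) : m (~` sphere) = 0%E ->
    m U = limn (fun k => \int[m]_(u in sphere) (bump U k u)%:E)%E.
  move=> m0; rewrite (on_sphere m0 mU).
  rewrite -(monotone_convergence m mS (g' := fun k u => (bump U k u)%:E)); first last.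
  - by move=> x _ k l kl; rewrite lee_fin bump_nd.
  - by move=> k x _; rewrite lee_fin bump_ge0.
  - move=> k; apply: measurable_funTS; apply/measurable_EFinP.
    exact: continuous_borelRn_measurable.
  under eq_integral do rewrite bump_lim//.
  by rewrite integral_indic// setIC.
rewrite (key m1)// (key m2)//; congr (limn _); apply/funext => k.
have fin (m : {measure set (borelRn R n) -> \bar R}) : (m setT < +oo)%E ->
    (\int[m]_(u in sphere) (bump U k u)%:E = (Rintegral m sphere (bump U k))%:E)%E.
  move=> mfin; rewrite /Rintegral fineK//; apply: integrable_fin_num => //.
  exact: (lipschitz_integrable mfin (bump_lip k U0)).
by rewrite !fin// (Rintegral_rotation_invariant (bump_lip k U0)).
Qed.

End rotation_invariant_measures.

(** * The hyperplane measure in polar coordinates *)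

Lemma measurable_invr (R : realType) :
  measurable_fun [set: measurableTypeR R] (fun r : R => r^-1 : measurableTypeR R).
Proof.
apply: measurable_fun_open_preimage => B oB.
rewrite -[X in measurable X](setUIDK _ ([set r : R | r != 0] : set (measurableTypeR R))).
apply: measurableU.
  apply: (@open_measurable R); rewrite openE => r [rB r0]; apply: filterI.
    exact: (inv_continuous r0) (open_nbhs_nbhs (conj oB rB)).
  by apply: open_nbhs_nbhs; split => //; exact: open_neq.
have [B0|B0] := pselect (B 0).
  rewrite (_ : _ `\` _ = [set 0]); first exact: measurable_set1.
  apply/seteqP; split => r /=; first by move=> [_ /negP]; rewrite negbK => /eqP.
  by move=> ->; rewrite invr0 eqxx.
rewrite (_ : _ `\` _ = set0)//; apply/seteqP; split => r //= [+ /negP].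
by rewrite negbK => + /eqP r0; rewrite r0 invr0.
Qed.

Section motion_invariance.
Context (R : realType) (d : nat) (hd : (2 <= d.+1)%N).
Local Notation n := d.+1.
Variable mu : {measure set (borelH R d) -> \bar R}.
Hypothesis mu_inv : motion_invariant mu.
Hypothesis mu_norm : width_normalized mu.
Implicit Types (H : hyperplane R n) (K M : set 'rV[R]_n) (x y z u v p b : 'rV[R]_n).
Implicit Types (Q : 'M[R]_n).

Lemma rotation1 : rotation (1%:M : 'M[R]_n).
Proof. by split; rewrite /orthogonal_mx ?trmx1 ?mulmx1 ?det1. Qed.

Lemma moveVK Q b x : orthogonal_mx Q -> move Q b (move Q^T (- (b *m Q^T)) x) = x.
Proof. by move=> oQ; rewrite /move mulmxDl mulNmx !orthogonal_mulVK// subrK. Qed.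

Lemma hyperplane_move Q b H : orthogonal_mx Q ->
  exists H', points H = move Q b @` points H'.
Proof.
move=> oQ; have [u [t [u0 Hut]]] := pointsP H.
have uQ0 : u *m Q^T != 0.
  by rewrite -enorm_eq0 orthogonal_enorm ?enorm_eq0//; exact: orthogonal_tr.
have [H' H'E] := hplane_hyperplane (t - dot b u) uQ0; exists H'.
rewrite H'E Hut; apply/seteqP; split=> [y yt|_ [x xt <-]]; rewrite /hplane/=.
  exists (move Q^T (- (b *m Q^T)) y); last exact: moveVK.
  by rewrite /hplane/= -orthogonal_dotr// -yt -{2}(moveVK b y oQ) dotDl addrK.
by rewrite dotDl orthogonal_dotr// xt subrK.
Qed.

Lemma measurable_hit M : convex_body M -> measurable (hit M : set (borelH R d)).
Proof.
move=> bM; have [[p Mp] cM _] := bM.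
pose f z := support_function M z - dot z p - enorm z ^+ 2.
have cf : continuous f.
  move=> z; apply: (@continuousB _ _ _ (fun z => support_function M z - dot z p)).
    apply: (@continuousB _ _ _ (support_function M)); last exact: continuous_dotl.
    by apply: support_function_continuous => //; exists p.
  apply: (@continuous_comp _ _ _ (@enorm R n) (fun r : R => r ^+ 2)).
    exact: continuous_enorm.
  exact: exprn_continuous.
rewrite (_ : hit M = foot p @^-1` (f @^-1` `[0, +oo[%classic)).
  rewrite -[X in measurable X]setTI; apply: measurable_foot => //.
  rewrite -[X in measurable X]setTI; apply: (continuous_borelRn_measurable cf) => //.
apply/seteqP; split => H /=; rewrite in_itv/= andbT /f sqr_enorm (dotC _ p) subr_ge0;
  by move/(hitE H bM Mp).
Qed.

(** Mean width is the measure of the set of hyperplanes hitting the body, and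
    hitting is preserved by rigid motions: the invariance of mean width comes
    from that of the hyperplane measure. *)
Lemma mean_width_move Q b M : rotation Q -> convex_body M ->
  mean_width (move Q b @` M) = mean_width M.
Proof.
move=> [oQ dQ] bM; have bQM := move_convex_body b oQ bM.
apply: EFin_inj; rewrite -!mu_norm//.
rewrite -(mu_inv (g := move Q b) _ (measurable_hit bM)); last by exists Q, b.
congr (mu _); apply/seteqP; split => H /=; last first.
  move=> [H' [x [H'x Mx]] HH']; rewrite /hit/= HH'.
  by exists (move Q b x); split; exists x.
have [H' HH'] := hyperplane_move b H oQ.
rewrite /hit/= {1}HH' => -[_ [[x H'x <-] [y My xy]]].
exists H' => //; exists x; split => //.
suff -> : x = y by [].
have /(congr1 (mulmx^~ Q^T)) : x *m Q = y *m Q by move/addIr: xy.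
by rewrite !orthogonal_mulK.
Qed.

Lemma mean_width_eball p (r : R) : 0 <= r -> mean_width (eball p r) = 2 * r.
Proof.
move=> r0; rewrite -(mean_width_eball0 d r0).
rewrite -(mean_width_move p rotation1 (eball_convex_body 0 r0)); congr mean_width.
by rewrite translate_eball add0r.
Qed.

Lemma mean_width_ge0 M : convex_body M -> 0 <= mean_width M.
Proof. by move=> bM; rewrite -lee_fin -mu_norm. Qed.

Local Notation polarT := (borelRn R n * measurableTypeR R)%type.

(** The outer unit normal and the distance from the pivot; hyperplanes through
    the pivot go to [(0, 0)] and form a null set. *)
Definition polar p (H : borelH R d) : polarT :=
  ((enorm (foot p H))^-1 *: foot p H, enorm (foot p H)).

Lemma measurable_polar p : measurable_fun [set: borelH R d] (polar p).
Proof.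
have me : measurable_fun [set: borelH R d]
    ((fun H => enorm (foot p H)) : borelH R d -> measurableTypeR R).
  apply: (@measurableT_comp _ _ _ _ (borelRn R n)); last exact: measurable_foot.
  by apply: continuous_borelRn_measurable; exact: continuous_enorm.
apply: measurable_fun_pair => //; apply: measurable_fun_coordinates => i.
rewrite (_ : (fun _ => _) = (fun H => (enorm (foot p H))^-1 * (foot p H) 0 i)); last first.
  by apply/funext => H; rewrite mxE.
have mc : measurable_fun [set: borelH R d]
    ((fun H => (foot p H) 0 i) : borelH R d -> measurableTypeR R).
  have mi : measurable_fun [set: borelRn R n]
      ((fun z : 'rV[R]_n => z 0 i) : borelRn R n -> measurableTypeR R).
    by apply: continuous_borelRn_measurable; exact: coord_continuous.
  exact: (measurableT_comp mi (measurable_foot p)).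
have mi : measurable_fun [set: borelH R d]
    ((fun H => (enorm (foot p H))^-1) : borelH R d -> measurableTypeR R).
  by apply: (@measurableT_comp _ _ _ _ (measurableTypeR R)); first exact: measurable_invr.
exact: measurable_funM mi mc.
Qed.


Definition polar_measure p : {measure set polarT -> \bar R} :=
  image_measure (measurable_polar p) mu.

Definition rotate_dir Q (q : polarT) : polarT := ((q.1 : 'rV[R]_n) *m Q, q.2).

Lemma measurable_rotate_dir Q : orthogonal_mx Q -> measurable_fun [set: polarT] (rotate_dir Q).
Proof.
move=> oQ; apply: measurable_fun_pair => //.
exact: (measurableT_comp (measurable_mulmx oQ) measurable_fst).
Qed.

Lemma polar_measure_move Q b p (B : set polarT) : rotation Q -> measurable B ->
  polar_measure (move Q b p) B = polar_measure p (rotate_dir Q @^-1` B).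
Proof.
move=> [oQ dQ] mB; rewrite [LHS]image_measureE [RHS]image_measureE.
have polarE H H' : points H' = move Q b @` points H ->
    polar (move Q b p) H' = rotate_dir Q (polar p H).
  move=> H'H; rewrite /polar (foot_move p oQ H'H) orthogonal_enorm//.
  by rewrite /rotate_dir/= -scalemxAl.
have mA : measurable (polar p @^-1` (rotate_dir Q @^-1` B)).
  rewrite -[X in measurable X]setTI; apply: measurable_polar => //.
  rewrite -[X in measurable X]setTI; exact: (measurable_rotate_dir oQ).
rewrite -[RHS](mu_inv (g := move Q b) _ mA); last by exists Q, b.
congr (mu _); apply/seteqP; split => H' /=.
  move=> BH'; have [H H'H] := hyperplane_move b H' oQ.
  by exists H => //; rewrite /= -(polarE _ _ H'H).
by move=> [H BH H'H]; rewrite (polarE _ _ H'H).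
Qed.

(** A translation carries one pivot to the other. *)
Lemma polar_measure_pivot p p' (B : set polarT) : measurable B ->
  polar_measure p B = polar_measure p' B.
Proof.
move=> mB; have := polar_measure_move (p - p') p' rotation1 mB.
rewrite /move mulmx1 addrC subrK => ->; congr (polar_measure _ _).
by apply/seteqP; split => -[u t]; rewrite /rotate_dir/= mulmx1.
Qed.

(** The rotation about the pivot is a rigid motion. *)
Lemma polar_measure_rotate p Q (B : set polarT) : rotation Q -> measurable B ->
  polar_measure p (rotate_dir Q @^-1` B) = polar_measure p B.
Proof.
move=> rQ mB; rewrite -(polar_measure_move (p - p *m Q) _ rQ mB).
by rewrite /move addrC subrK.
Qed.

(** A hyperplane is at distance at most [r] from the pivot exactly when it hits
    the ball of radius [r], whose mean width is [2 * r]. *)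
Lemma polar_measure_disc p (r : R) : 0 <= r ->
  polar_measure p [set q | q.2 <= r] = (2 * r)%:E.
Proof.
move=> r0; have b0 := eball_convex_body p r0.
rewrite image_measureE -(mean_width_eball p r0) -mu_norm//; congr (mu _).
have pp : eball p r p by rewrite /eball/= subrr enorm0.
have hE z : support_function (eball p r) z - dot p z = r * enorm z.
  have [b00 cb0 _] := eball_convex_body (0 : 'rV[R]_n) r0.
  rewrite -(support_function_eball0 z r0).
  have := support_function_move p z rotation1.1 b00 cb0.
  by rewrite trmx1 mulmx1 translate_eball add0r => ->; rewrite addrK.
apply/seteqP; split => H /=.
  move=> zr; apply/(hitE H b0 pp); rewrite hE -sqr_enorm expr2.
  by rewrite ler_wpM2r ?enorm_ge0.
move/(hitE H b0 pp); rewrite hE -sqr_enorm expr2.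
have [z0|z0] := eqVneq (enorm (foot p H)) 0; first by rewrite z0.
by rewrite ler_pM2r// lt0r z0 enorm_ge0.
Qed.

End motion_invariance.

Section polar_decomposition.
Context (R : realType) (d : nat) (hd : (2 <= d.+1)%N).
Local Notation n := d.+1.
Variable mu : {measure set (borelH R d) -> \bar R}.
Hypothesis mu_inv : motion_invariant mu.
Hypothesis mu_norm : width_normalized mu.
Implicit Types (p u : 'rV[R]_n) (T : set (measurableTypeR R)).
Local Notation polarT := (borelRn R n * measurableTypeR R)%type.
Local Notation leb := (@lebesgue_measure R).
Local Notation sphere := (@unit_sphere R n : set (borelRn R n)).
Local Notation polarm := (polar_measure mu).

Local Notation pos := (`]0%R, +oo[%classic : set (measurableTypeR R)).

Local Notation uitv := (`]0%R, 1%R]%classic : set (measurableTypeR R)).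

Let measurable_slab T : measurable T -> measurable ([set: borelRn R n] `*` T).
Proof. by move=> mT; exact: measurableX. Qed.

Let mpos : measurable pos.
Proof. exact: measurable_itv. Qed.

(** A difference of two closed balls, hence the half-open interval. *)
Let polar_itv p (a b : R) : 0 <= a -> a <= b ->
  polarm p ([set: borelRn R n] `*` `]a, b]%classic) = (2 * (b - a))%:E.
Proof.
move=> a0 ab; have b0 := le_trans a0 ab.
have mle c : measurable ([set q : polarT | q.2 <= c]).
  rewrite (_ : [set _ | _] = snd @^-1` `]-oo, c]%classic).
    rewrite -[X in measurable X]setTI; apply: measurable_snd => //.
  by apply/seteqP; split => q /=; rewrite in_itv.
have mab : measurable ([set: borelRn R n] `*` (`]a, b]%classic : set (measurableTypeR R))).
  exact: measurable_slab.
have := polar_measure_disc mu_inv mu_norm p b0.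
rewrite (_ : [set q : polarT | q.2 <= b] =
  [set q : polarT | q.2 <= a] `|` [set: borelRn R n] `*` `]a, b]%classic); last first.
  apply/seteqP; split => q /=; rewrite in_itv/=.
    by move=> qb; case: (leP q.2 a) => qa; [left|right].
  by move=> [/le_trans|[_ /andP[]]]; first exact.
rewrite measureU//; last first.
  apply/seteqP; split => // q [/= qa [_]]; rewrite in_itv/= => /andP[aq _].
  by move: (lt_le_trans aq qa); rewrite ltxx.
rewrite [X in (X + _)%E](polar_measure_disc mu_inv mu_norm p a0).
have arith (x : \bar R) : ((2 * a)%:E + x = (2 * b)%:E -> x = (2 * (b - a))%:E)%E.
  case: x => [r| |]//; rewrite -EFinD => -[h].
  by congr EFin; rewrite mulrBr -h addrC addKr.
exact: arith.
Qed.

(** The normalization on balls fixes the measure of [{a < t <= b}] for all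
    [0 <= a <= b], hence the distribution of the distance to the pivot. *)
Lemma polar_measure_radial p T : measurable T -> T `<=` `]0, +oo[%classic ->
  polarm p ([set: borelRn R n] `*` T) = (2%:E * leb T)%E.
Proof.
move=> mT T0.
pose m1 : {measure set (measurableTypeR R) -> \bar R} := mrestr (image_measure measurable_snd (polarm p)) mpos.
pose m2 : {measure set (measurableTypeR R) -> \bar R} := mscale (NngNum (ler0n R 2)) (mrestr leb mpos).
have m1E (A : set (measurableTypeR R)) : m1 A = polarm p ([set: borelRn R n] `*` (A `&` pos)).
  transitivity (polarm p (snd @^-1` (A `&` pos))); first by [].
  by congr (polarm p _); apply/seteqP; split => // q [].
have m2E (A : set (measurableTypeR R)) : m2 A = (2%:E * leb (A `&` pos))%E by [].
rewrite -{1 2}(setIidl T0) -m1E -m2E.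
apply: (@measure_unique _ R (measurableTypeR R) (@ocitv R)
  (fun k => `]- k%:R, k%:R]%classic) _ _ _ _ m1 m2) => //.
- exact: ocitvI.
- by move=> k; exact: is_ocitv.
- apply/seteqP; split => // x _; exists (Num.truncn `|x|).+1 => //=.
  rewrite in_itv/=; have := truncnS_gt `|x|.
  by rewrite ltr_norml => /andP[-> /ltW].
- move=> _ [[a b] _ <-] /=.
  rewrite m1E m2E (_ : `]a, b] `&` `]0, +oo[ = `]Num.max a 0, b])%classic; last first.
    apply/seteqP; split => x /=; rewrite !in_itv/= gt_max andbT.
      by move=> [/andP[-> ->] ->].
    by move=> /andP[/andP[-> ->] ->].
  set a' := Num.max a 0; have a'0 : 0 <= a' by rewrite le_max lexx orbT.
  have [ab|ba] := leP a' b.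
    rewrite polar_itv// EFinM; congr (_ * _)%E; have := @lebesgue_measure_itv R `]a', b].
    rewrite /= lte_fin; move: ab; rewrite le_eqVlt => /orP[/eqP <-|->] /= -> //.
    by rewrite ltxx subrr.
  have -> : `]a', b]%classic = set0 :> set R.
    by apply: set_itv_ge; rewrite -leNgt /= bnd_simp ltW.
  by rewrite setX0 !measure0 mule0.
- move=> k; rewrite m1E.
  apply: (@le_lt_trans _ _ (polarm p [set q : polarT | q.2 <= k%:R])); last first.
    by rewrite (polar_measure_disc mu_inv mu_norm)// ltry.
  apply: le_measure; rewrite ?inE.
  + by apply: measurable_slab; apply: measurableI => //; exact: measurable_itv.
  + rewrite (_ : [set _ | _] = snd @^-1` `]-oo, k%:R]%classic).
      by rewrite -[X in measurable X]setTI; apply: measurable_snd.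
    by apply/seteqP; split => q /=; rewrite in_itv.
  + by move=> q [_ [/=]]; rewrite in_itv/= => /andP[].
Qed.

Let mslab_restr p T (mT : measurable T) : {measure set (borelRn R n) -> \bar R} :=
  image_measure measurable_fst (mrestr (polarm p) (measurable_slab mT)).

Let mslab_restrE p T (mT : measurable T) (A : set (borelRn R n)) :
  mslab_restr p mT A = polarm p (A `*` T).
Proof.
rewrite /mslab_restr image_measureE /= /mrestr; congr (polarm p _).
by apply/seteqP; split => -[u t]; [case=> Au [_ Tt]|case=> Au Tt].
Qed.

Let mslab_restr_rot p T (mT : measurable T) : rotation_invariant (mslab_restr p mT).
Proof.
move=> Q A rQ mA; rewrite !mslab_restrE.
by rewrite -[RHS](polar_measure_rotate mu_inv p rQ)//; exact: measurableX.
Qed.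

Let mslab_restr_sphere p T (mT : measurable T) : T `<=` `]0, +oo[%classic ->
  mslab_restr p mT (~` sphere) = 0%E.
Proof.
move=> T0; rewrite mslab_restrE image_measureE.
rewrite (_ : _ @^-1` _ = set0) ?measure0//; apply/seteqP; split => // H [/= Su].
move=> /T0; rewrite /= in_itv/= andbT => t0; apply: Su.
by rewrite /unit_sphere/= enormZ ger0_norm ?invr_ge0 ?(ltW t0)// mulVf// gt_eqF.
Qed.

(** For fixed [T] both sides are rotation invariant measures in [A], carried by
    the sphere and of the same total mass. So the direction and the distance
    are independent. *)
Lemma polar_measureX p (A : set (borelRn R n)) T : measurable A -> measurable T ->
  T `<=` `]0, +oo[%classic -> (leb T < +oo)%E ->
  polarm p (A `*` T) = (polarm p (A `*` uitv) * leb T)%E.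
Proof.
move=> mA mT T0 Toy.
have Tfin : leb T \is a fin_num by rewrite ge0_fin_numE.
have r0 : 0 <= fine (leb T) by rewrite fine_ge0.
have m1 : measurable uitv by exact: measurable_itv.
have T10 : uitv `<=` pos by move=> x /=; rewrite !in_itv/= => /andP[->].
have leb1 : leb uitv = 1%E.
  by have := @lebesgue_measure_itv R `]0, 1]; rewrite /= lte_fin ltr01 sube0.
rewrite -(mslab_restrE p mT) -(mslab_restrE p m1) -(fineK Tfin) muleC.
pose m2 : {measure set (borelRn R n) -> \bar R} := mscale (NngNum r0) (mslab_restr p m1).
have m2E (B : set (borelRn R n)) : m2 B = ((fine (leb T))%:E * mslab_restr p m1 B)%E by [].
rewrite -m2E.
apply: (rotation_invariant_measure_unique hd) => //.
- by rewrite mslab_restrE polar_measure_radial// lte_mul_pinfty ?lee_fin.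
- rewrite m2E !mslab_restrE !polar_measure_radial// leb1 mule1.
  by rewrite fineK// muleC.
- exact: mslab_restr_sphere.
- by rewrite m2E mslab_restr_sphere ?mule0.
- by move=> Q B rQ mB; rewrite !m2E mslab_restr_rot.
Qed.

Lemma lebesgue_shift (c : R) T : measurable T ->
  leb ((fun t => t - c) @^-1` T) = leb T.
Proof.
move=> mT; have mc : measurable_fun [set: measurableTypeR R]
    ((fun t => t - c) : measurableTypeR R -> measurableTypeR R).
  by apply: measurable_funB => //; exact: measurable_cst.
rewrite -(image_measureE mc leb); apply/esym; apply: lebesgue_measure_unique => //.
move=> _ [[a b] _ <-] /=; rewrite (image_measureE mc).
rewrite (_ : _ @^-1` _ = `]a + c, b + c]%classic); last first.
  by apply/seteqP; split => x /=; rewrite !in_itv/= ltrBrDr lerBlDr.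
have := @lebesgue_measure_itv R `]a, b]; have := @lebesgue_measure_itv R `]a + c, b + c].
rewrite /= !lte_fin ltrD2r => -> ->; case: ifP => // _.
by rewrite -!EFinB; congr EFin; ring.
Qed.

End polar_decomposition.

(** * The distribution of a random hyperplane *)

Section sample_coordinates.
Context (R : realType) (d : nat) (hd : (2 <= d.+1)%N).
Local Notation n := d.+1.
Variable mu : {measure set (borelH R d) -> \bar R}.
Hypothesis mu_inv : motion_invariant mu.
Hypothesis mu_norm : width_normalized mu.
Implicit Types (p u : 'rV[R]_n) (T : set (measurableTypeR R)) (K : set 'rV[R]_n).
Local Notation polarT := (borelRn R n * measurableTypeR R)%type.
Local Notation leb := (@lebesgue_measure R).
Local Notation sphere := (@unit_sphere R n : set (borelRn R n)).
Local Notation polarm := (polar_measure mu).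
Local Notation uitv := (`]0%R, 1%R]%classic : set (measurableTypeR R)).
Local Notation citv := (`[0%R, 1%R]%classic : set (measurableTypeR R)).

Definition shear (f : 'rV[R]_n -> R) (q : polarT) : polarT := (q.1, q.2 - f q.1).

Lemma measurable_shear f : continuous f -> measurable_fun [set: polarT] (shear f).
Proof.
move=> cf; apply: measurable_fun_pair => //.
have mf : measurable_fun [set: polarT] ((fun q : polarT => f q.1) : polarT -> measurableTypeR R).
  exact: (measurableT_comp (continuous_borelRn_measurable cf) measurable_fst).
by apply: measurable_funB => //; exact: measurable_snd.
Qed.

Let mu_itv : measurable uitv. Proof. exact: measurable_itv. Qed.
Let mc_itv : measurable citv. Proof. exact: measurable_itv. Qed.
Let mS : measurable sphere. Proof. exact: measurable_unit_sphere. Qed.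

(** Truncation at the distance [b] makes all measures finite; hyperplanes near a
    given body have bounded distance from the pivot. *)
Let polarm_section p (b : R) :
  exists alpha : {measure set (borelRn R n) -> \bar R},
  forall X : set polarT, measurable X ->
  X `<=` [set: borelRn R n] `*` (`]0%R, b]%classic : set (measurableTypeR R)) ->
  polarm p X = (\int[alpha]_u leb (xsection X u))%E.
Proof.
have mb : measurable (`]0%R, b]%classic : set (measurableTypeR R)) by exact: measurable_itv.
have mslab T : measurable T -> measurable ([set: borelRn R n] `*` T).
  by move=> mT; exact: measurableX.
pose alpha : {measure set (borelRn R n) -> \bar R} :=
  image_measure measurable_fst (mrestr (polarm p) (mslab _ mu_itv)).
have alphaE A : alpha A = polarm p (A `*` uitv).
  transitivity (polarm p ((fst @^-1` A) `&` ([set: borelRn R n] `*` uitv))); first by [].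
  by congr (polarm p _); apply/seteqP; split => -[u t]; [case=> Au [_ Tt]|case=> Au Tt].
have afin : fin_num_fun alpha.
  move=> A mA; rewrite ge0_fin_numE//.
  apply: (@le_lt_trans _ _ (alpha setT)); first by apply: le_measure; rewrite ?inE.
  rewrite alphaE (polar_measure_radial mu_inv mu_norm)//.
    have := @lebesgue_measure_itv R `]0, 1]; rewrite /= lte_fin ltr01 => ->.
    by rewrite sube0 mule1 ltry.
  by move=> x /=; rewrite !in_itv/= => /andP[->].
pose L : {measure set (measurableTypeR R) -> \bar R} := mrestr leb mb.
have lebb : (leb (`]0%R, b]%classic : set (measurableTypeR R)) < +oo)%E.
  have := @lebesgue_measure_itv R `]0, b]; rewrite /= => ->.
  by case: ifP => // _; rewrite -EFinB ltry.
have Lfin : fin_num_fun L.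
  move=> A mA; rewrite ge0_fin_numE//; apply: le_lt_trans lebb.
  have mAb := measurableI _ _ mA mb.
  by apply: le_measure; rewrite ?inE// => x [].
pose alpha' : {finite_measure set (borelRn R n) -> \bar R} :=
  HB.pack (alpha : set _ -> _) (Measure.on alpha) (Measure_isFinite.Build _ _ _ alpha afin).
pose L' : {finite_measure set (measurableTypeR R) -> \bar R} :=
  HB.pack (L : set _ -> _) (Measure.on L) (Measure_isFinite.Build _ _ _ L Lfin).
pose nub : {measure set polarT -> \bar R} := mrestr (polarm p) (mslab _ mb).
exists alpha => X mX Xb.
have -> : polarm p X = nub X.
  transitivity (polarm p (X `&` ([set: borelRn R n] `*` `]0%R, b]%classic))); last by [].
  by rewrite setIidl.
have nubE A B : measurable A -> measurable B -> nub (A `*` B) = (alpha' A * L' B)%E.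
  move=> mA mB.
  transitivity (polarm p ((A `*` B) `&` ([set: borelRn R n] `*` `]0%R, b]%classic))); first by [].
  have mBb := measurableI _ _ mB mb.
  rewrite -setXI setIT (polar_measureX hd mu_inv mu_norm)//.
  - by rewrite -alphaE.
  - by move=> t [_] /=; rewrite !in_itv/= => /andP[->].
  - by apply: le_lt_trans lebb; apply: le_measure; rewrite ?inE// => x [].
rewrite -(product_measure_unique (m1 := alpha') (m2 := L') nubE mX).
rewrite /product_measure1; apply: eq_integral => u _ /=.
rewrite /L /mrestr/= setIidl// => t; rewrite /xsection/= => /set_mem/Xb[]//.
Qed.

(** By Fubini, the offset [f u] may be subtracted on each line of constant
    direction, where the measure is a multiple of Lebesgue measure. The
    endpoint zero, a null set, is dropped on the right, where distances are
    measured from the pivot itself. *)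
Lemma polar_measure_shear p (f : 'rV[R]_n -> R) (A : set polarT) :
  continuous f -> (forall u, unit_sphere u -> 0 < f u) -> measurable A ->
  polarm p (shear f @^-1` (A `&` (sphere `*` citv))) = polarm p (A `&` (sphere `*` uitv)).
Proof.
move=> cf f0 mA.
have [u0 Su0] := unit_sphere_inhabited R hd.
have cS := @compact_unit_sphere R n.
have [||umax /set_mem Smax fmax] := @compact_EVT_max _ R f _ _ cS.
- by exists u0.
- exact: continuous_subspaceT.
pose b := f umax + 1.
have b1 : 1 <= b by rewrite /b lerDr ltW// f0.
have fb u : unit_sphere u -> f u + 1 <= b by move=> Su; rewrite lerD2r fmax//; exact: mem_set.
have [alpha hE] := polarm_section p b.
rewrite !hE.
- apply: eq_integral => u _.
  have [Su|Su] := pselect (unit_sphere u); last first.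
    rewrite (_ : xsection _ u = set0); last first.
      by apply/seteqP; split => // t; rewrite /xsection/= => /set_mem[_ [/Su]].
    rewrite (_ : xsection _ u = set0)//.
    by apply/seteqP; split => // t; rewrite /xsection/= => /set_mem[_ [/Su]].
  have mAu : measurable (xsection A u) by exact: measurable_xsection.
  rewrite (_ : xsection _ u = (fun t => t - f u) @^-1` (xsection A u `&` citv)); last first.
    apply/seteqP; split => t; rewrite /xsection/=.
      by move=> /set_mem[/= At [_ t01]]; split => //; exact: mem_set.
    by move=> [/set_mem At t01]; apply/mem_set; split.
  rewrite lebesgue_shift; last exact: measurableI.
  rewrite [in RHS](_ : xsection _ u = xsection A u `&` uitv); last first.
    apply/seteqP; split => t; rewrite /xsection/=.
      by move=> /set_mem[At [_ t01]]; split => //; exact: mem_set.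
    by move=> [/set_mem At t01]; apply/mem_set; split.
  apply/eqP; rewrite eq_le; apply/andP; split; last first.
    apply: le_measure; rewrite ?inE; [exact: measurableI..|].
    by apply: setIS => t /=; rewrite !in_itv/= => /andP[/ltW -> ->].
  apply: (@le_trans _ _ (leb ((xsection A u `&` uitv) `|` [set 0]))).
    apply: le_measure; rewrite ?inE; [exact: measurableI| |].
      by apply: measurableU; [exact: measurableI|exact: measurable_set1].
    move=> t [At] /=; rewrite !in_itv/= => /andP[t0 t1].
    move: t0; rewrite le_eqVlt => /orP[/eqP <-|t0]; first by right.
    have t01 : t \in `]0%R, 1%R] by rewrite in_itv/= t0 t1.
    by left.
  have mAi : measurable (xsection A u `&` uitv) by exact: measurableI.
  have m0 : measurable ([set 0] : set (measurableTypeR R)) by exact: measurable_set1.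
  apply: le_trans (measureU2 _ mAi m0) _.
  by rewrite [X in (_ + X)%E](lebesgue_measure_set1 0) adde0.
- by apply: measurableI => //; exact: measurableX.
- move=> q [_ [_]] /=; rewrite !in_itv/= => /andP[-> q1]; split => //=.
  exact: le_trans b1.
- rewrite -[X in measurable X]setTI; apply: measurable_shear => //.
  by apply: measurableI => //; exact: measurableX.
- move=> q [_ [/= Sq]]; rewrite !in_itv/= => /andP[q0 q1]; split => //=.
  have := f0 _ Sq; have := fb _ Sq; move: q0 q1; lra.
Qed.

Definition offset K p u : R := support_function K u - dot p u.

(** For a hyperplane near [K]: its outer unit normal and its distance to the
    supporting hyperplane with that normal. *)
Definition coordinates K p : borelH R d -> polarT := shear (offset K p) \o polar p.

Lemma offset_continuous K p : convex_body K -> continuous (offset K p).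
Proof.
move=> [K0 cK _] u; apply: (@continuousB _ _ _ (support_function K)).
  exact: support_function_continuous.
rewrite (_ : dot p = (fun u => dot u p)); first exact: continuous_dotl.
by apply/funext => v; rewrite dotC.
Qed.

Lemma measurable_coordinates K p : convex_body K ->
  measurable_fun [set: borelH R d] (coordinates K p).
Proof.
move=> bK.
have mK := measurable_shear (@offset_continuous K p bK).
exact: (measurableT_comp mK (measurable_polar p)).
Qed.

Lemma offset_gt0 K p u : convex_body K -> K° p -> unit_sphere u -> 0 < offset K p u.
Proof.
move=> [_ cK _] /interior_eball[r r0 rK] Su.
have /(support_function_ge u cK) : K (p + r *: u).
  by apply: rK; rewrite /eball/= addrC addKr enormZ Su mulr1 gtr0_norm.
have uu : dot u u = 1 by rewrite -sqr_enorm Su expr1n.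
by rewrite dotDl dotZl uu mulr1 /offset; move: r0; lra.
Qed.

(** This is [near_hyperplanesE] divided by the norm of the foot. *)
Lemma near_coordinates K p (H : hyperplane R n) : convex_body K -> K° p ->
  near_hyperplanes K H <-> (sphere `*` citv) (coordinates K p H).
Proof.
move=> bK Kp; have [K0 cK _] := bK; rewrite (near_hyperplanesE H bK Kp).
rewrite /coordinates /shear /polar /=; set z := foot p H.
have [z0|z0] := eqVneq z 0.
  split=> [[]//|[/=]]; rewrite z0 /unit_sphere/= scaler0 enorm0.
  by move/esym/eqP; rewrite oner_eq0.
have ez : 0 < enorm z by rewrite enorm_gt0.
have Su : unit_sphere ((enorm z)^-1 *: z).
  by rewrite /unit_sphere/= enormZ ger0_norm ?invr_ge0 ?(ltW ez)// mulVf// gt_eqF.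
have E : dot z z - (support_function K z - dot p z) =
    enorm z * (enorm z - offset K p ((enorm z)^-1 *: z)).
  rewrite /offset support_functionZ ?invr_ge0 ?(ltW ez)// dotZr -sqr_enorm.
  by field; rewrite gt_eqF.
rewrite E; split.
  move=> [_ /andP[h1 h2]]; split => //=; rewrite in_itv/=.
  by move: h1 h2; rewrite pmulr_rge0// ger_pMr// => -> ->.
move=> [_] /=; rewrite in_itv/= => /andP[h1 h2]; split => //.
by rewrite pmulr_rge0// ger_pMr// h1 h2.
Qed.

Lemma Hminus_coordinates K p H : convex_body K -> K° p -> near_hyperplanes K H ->
  Hminus K H = [set y | dot y (coordinates K p H).1 <=
    support_function K (coordinates K p H).1 + (coordinates K p H).2].
Proof.
move=> bK Kp HK; have /(near_hyperplanesE _ bK Kp)[z0 _] := HK.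
rewrite (HminusE bK Kp HK); rewrite /coordinates /shear /polar /= /offset.
set z := foot p H in z0 *; have ez : 0 < enorm z by rewrite enorm_gt0.
apply/seteqP; split => y /=; rewrite dotBl !dotZr -sqr_enorm expr2 => h.
  have : (enorm z)^-1 * (dot y z - dot p z) <= enorm z.
    by rewrite mulrC ler_pdivrMr.
  by rewrite mulrBr; set c := support_function _ _; lra.
rewrite -ler_pdivrMr// mulrC mulrBr.
by move: h; set c := support_function _ _; lra.
Qed.

(** Written with the pivot at the origin and without reference to a body, this
    turns out to be the distribution of the coordinates for every body. *)
Definition coordinate_law (A : set polarT) : \bar R :=
  (2^-1%:E * polarm 0 (A `&` (sphere `*` uitv)))%E.

Lemma muK_coordinates K p (A : set polarT) : convex_body K -> K° p -> measurable A ->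
  muK mu K (coordinates K p @^-1` A) = coordinate_law A.
Proof.
move=> bK Kp mA; rewrite /muK /coordinate_law; congr (_ * _)%E.
have mAS : measurable (A `&` (sphere `*` uitv)).
  by apply: measurableI => //; exact: measurableX.
rewrite (polar_measure_pivot mu_inv 0 p mAS).
rewrite -(polar_measure_shear p (@offset_continuous K p bK) _ mA); last first.
  by move=> u; exact: offset_gt0.
transitivity (mu (polar p @^-1` (shear (offset K p) @^-1` (A `&` (sphere `*` citv))))); last by [].
congr (mu _); apply/seteqP; split => H [AH /(near_coordinates H bK Kp) SH]; split => //.
Qed.

Lemma coordinate_law_rotate Q (A : set polarT) : rotation Q -> measurable A ->
  coordinate_law (rotate_dir Q @^-1` A) = coordinate_law A.
Proof.
move=> rQ mA; rewrite /coordinate_law; congr (_ * _)%E.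
have mAS : measurable (A `&` (sphere `*` uitv)).
  by apply: measurableI => //; exact: measurableX.
rewrite -(polar_measure_rotate mu_inv 0 rQ mAS); congr (polarm 0 _).
apply/seteqP; split => q [AH [Sq t]]; split => //; split => //.
  by rewrite /unit_sphere/= orthogonal_enorm//; case: rQ.
by move: Sq; rewrite /unit_sphere/= orthogonal_enorm//; case: rQ.
Qed.

End sample_coordinates.

(** * Joint distributions *)

Section joint_laws.
Context d (E : measurableType d) (R : realType) (N : nat).

Definition rectangles : set (set ('I_N -> E)) :=
  [set B | exists A : 'I_N -> set E, (forall i, measurable (A i)) /\
                                     B = [set x | forall i, A i (x i)]].

(** The product sigma-algebra; the measurable boxes that generate it are stable
    under intersection, so they determine finite measures. *)
Definition sampleT := g_sigma_algebraType rectangles.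

Lemma measurable_rectangle (A : 'I_N -> set E) : (forall i, measurable (A i)) ->
  measurable ([set x | forall i, A i (x i)] : set sampleT).
Proof. by move=> mA; apply: sub_sigma_algebra; exists A. Qed.

Lemma measurable_fun_sample d' (T : measurableType d') (X : 'I_N -> T -> E) :
  (forall i, measurable_fun [set: T] (X i)) ->
  measurable_fun [set: T] ((fun w i => X i w) : T -> sampleT).
Proof.
move=> mX; apply: (@measurability _ _ T sampleT _ _ rectangles) => //.
move=> _ [_ [A [mA ->]] <-]; rewrite setTI.
rewrite (_ : _ @^-1` _ = \bigcap_(i in [set: 'I_N]) (X i @^-1` A i)).
  apply: fin_bigcap_measurable => [|i _]; first exact: finite_finset.
  by rewrite -[X in measurable X]setTI; apply: mX.
by apply/seteqP; split => w /= h i; [move=> _; exact: h|exact: h].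
Qed.

Lemma rectangle_law_unique (Q1 Q2 : {measure set sampleT -> \bar R}) :
  (Q1 setT < +oo)%E ->
  (forall A : 'I_N -> set E, (forall i, measurable (A i)) ->
     Q1 [set x | forall i, A i (x i)] = Q2 [set x | forall i, A i (x i)]) ->
  forall B, measurable B -> Q1 B = Q2 B.
Proof.
move=> Q1fin Q12; apply: (@measure_unique _ R sampleT rectangles (fun=> setT)) => //.
- move=> _ _ [A [mA ->]] [B [mB ->]]; exists (fun i => A i `&` B i); split.
    by move=> i; exact: measurableI.
  by apply/seteqP; split => x /=; [move=> [h1 h2] i; split|move=> h; split => i; case: (h i)].
- by move=> _; exists (fun=> setT); split => //; apply/seteqP; split.
- by apply/seteqP; split => // x _; exists 0%N.
- by move=> _ [A [mA ->]]; exact: Q12.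
Qed.

Lemma independent_rectangle d' (T : measurableType d') (P : probability T R)
    d'' (T' : measurableType d'') (H : 'I_N -> T -> T') (c : T' -> E)
    (law : set E -> \bar R) :
  mutually_independent P H -> measurable_fun [set: T'] c ->
  (forall i A, measurable A -> P (H i @^-1` (c @^-1` A)) = law A) ->
  forall A : 'I_N -> set E, (forall i, measurable (A i)) ->
  P [set w | forall i, A i (c (H i w))] = (\prod_(i < N) law (A i))%E.
Proof.
move=> indH mc lawE A mA.
have mcA i : measurable (c @^-1` A i) by rewrite -[X in measurable X]setTI; exact: mc.
have := indH [set: 'I_N]%SET (fun i => c @^-1` A i) mcA.
rewrite (_ : \bigcap_(i in _) _ = [set w | forall i, A i (c (H i w))]); last first.
  apply/seteqP; split => w /= h i; first by apply: h; rewrite /= inE.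
  by move=> _; exact: h.
move=> ->; under eq_bigl do rewrite inE.
by apply: eq_bigr => i _; exact: lawE.
Qed.

End joint_laws.

(** * The width of the cut body as a function of the sample *)

Section cut_width.
Context (R : realType) (d N : nat).
Local Notation n := d.+1.
Implicit Types (K L : set 'rV[R]_n).
Local Notation polarT := (borelRn R n * measurableTypeR R)%type.
Local Notation sampleR := (sampleT polarT N).

Definition admissible_sample : set sampleR := @admissible R n N.

Definition cut_width K (x : sampleR) : R := mean_width (cut K (x : 'I_N -> 'rV[R]_n * R)).

Lemma measurable_admissible : measurable admissible_sample.
Proof.
have mA : measurable ((@unit_sphere R n : set (borelRn R n)) `*`
    (`[0%R, 1%R]%classic : set (measurableTypeR R))).
  by apply: measurableX; [exact: measurable_unit_sphere|exact: measurable_itv].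
exact: (@measurable_rectangle _ polarT N (fun=> _) (fun=> mA)).
Qed.

Let rat_box (q : 'rV[rat]_n * rat) (k : nat) : set polarT :=
  ball (map_mx ratr q.1 : 'rV[R]_n) k.+1%:R^-1 `*` ball (ratr q.2 : R) k.+1%:R^-1.

Let measurable_rat_box q k : measurable (rat_box q k).
Proof.
apply: measurableX; last exact: measurable_ball.
by apply: open_measurableRn; apply: ball_open; rewrite invr_gt0.
Qed.

Let exists_rat_box (y : 'rV[R]_n * R) k : exists q, rat_box q k y.
Proof.
set r : R := k.+1%:R^-1; have r0 : 0 < r by rewrite invr_gt0.
have hq (t : R) : {q : rat | `|ratr q - t| < r}.
  apply/cid; have : t - r < t + r by rewrite ltrD2l gtrN.
  move=> /rat_in_itvoo[q]; rewrite in_itv/= => /andP[q1 q2]; exists q.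
  by rewrite ltr_distl q1.
exists (\row_i sval (hq (y.1 0 i)), sval (hq y.2)); split => /=; last first.
  by rewrite -ball_normE; exact: svalP (hq y.2).
by apply/ball_rowP => // i; rewrite !mxE; exact: svalP (hq (y.1 0 i)).
Qed.

Lemma cut_width_perturb K r0 r1 x x' dt e : 0 < r0 -> 0 <= dt -> 0 < e ->
  convex_body K -> eball 0 r0 `<=` K -> K `<=` eball 0 r1 ->
  admissible_sample x -> admissible_sample x' ->
  (forall i, enorm ((x i).1 - (x' i).1 : 'rV[R]_n) <= dt /\ `|(x i).2 - (x' i).2 : R| <= dt) ->
  dt * (r1 + r1 + 2) <= e * r0 -> cut_width K x <= (1 + e) * cut_width K x'.
Proof.
move=> r00 dt0 e0 bK rK Kr Dx Dx' xx' dte.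
have bx := cut_convex_body bK Dx; have bx' := cut_convex_body bK Dx'.
have e1 : 0 <= 1 + e by rewrite addr_ge0// ltW.
rewrite -mean_widthZ//; apply: mean_width_sub => //.
  exact: minkowski_convex_body.
exact: cut_perturb r00 dt0 e0 bK rK Kr Dx Dx' xx' dte.
Qed.

(** Within the admissible samples the width of the cut body varies
    continuously, so its upper level sets are traces of countable unions of
    rational boxes. *)
Lemma measurable_cut_width K r0 : 0 < r0 -> convex_body K -> eball 0 r0 `<=` K ->
  measurable_fun admissible_sample (cut_width K : sampleR -> measurableTypeR R).
Proof.
move=> r00 bK rK; have [K0 cK _] := bK.
have [r1 r10 Kr1] := compact_enorm_bounded cK.
have Kr : K `<=` eball 0 r1 by move=> y Ky; rewrite /eball/= subr0; exact: Kr1.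
apply: (measurability _ (RGenOInfty.measurableE R)) => _ [_ [a ->] <-].
pose good (b : {ffun 'I_N -> 'rV[rat]_n * rat} * nat) := [set x : sampleR |
  forall i, rat_box (b.1 i) b.2 (x i)].
rewrite (_ : _ `&` _ = admissible_sample `&` \bigcup_(b in [set b |
    forall x, admissible_sample x -> good b x -> a < cut_width K x]) good b).
  apply: measurableI; first exact: measurable_admissible.
  rewrite bigcup_mkcond.
  apply: countable_bigcupT_measurable => [|b]; first exact: countableP.
  case: ifPn => // _.
  exact: (@measurable_rectangle _ polarT N (fun i => rat_box (b.1 i) b.2)
    (fun i => measurable_rat_box _ _)).
apply/seteqP; split => x [Dx]; last first.
  by move=> [b /= hb xb]; split => //=; rewrite in_itv/= andbT; exact: hb.
rewrite /= in_itv/= andbT => ax; split => //.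
pose e := (cut_width K x - a) / (`|a| + 1) / 2.
have a1 : 0 < `|a| + 1 by rewrite ltr_wpDl.
have e0 : 0 < e by rewrite !divr_gt0// subr_gt0.
have ea : (1 + e) * a < cut_width K x.
  have : e * a <= e * (`|a| + 1).
    by rewrite ler_wpM2l ?(ltW e0)// (le_trans (ler_norm a))// lerDl.
  have -> : e * (`|a| + 1) = (cut_width K x - a) / 2 by rewrite /e mulrAC divfK// gt_eqF.
  by move: ax; lra.
pose dt := e * r0 / (r1 + r1 + 2).
have r12 : 0 < r1 + r1 + 2 by rewrite !addr_gt0.
have dt0 : 0 < dt by rewrite divr_gt0// mulr_gt0.
pose k := Num.truncn (dt / (n%:R + 1) / 2)^-1.
have n1 : 0 < n%:R + 1 :> R by rewrite ltr_wpDl.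
have kd : (n%:R + 1) * (k.+1%:R^-1 + k.+1%:R^-1) <= dt :> R.
  have d20 : 0 < dt / (n%:R + 1) / 2 by rewrite divr_gt0// divr_gt0.
  have : k.+1%:R^-1 <= dt / (n%:R + 1) / 2 :> R.
    rewrite invf_ple ?posrE//; exact/ltW/truncnS_gt.
  rewrite ler_pdivlMr// ler_pdivlMr// => h; apply: le_trans h.
  by rewrite le_eqVlt; apply/orP; left; apply/eqP; ring.
pose b := ([ffun i => sval (cid (exists_rat_box (x i) k))], k).
have xb : good b x by move=> i; rewrite ffunE; exact: svalP (cid (exists_rat_box (x i) k)).
exists b => //= x' Dx' x'b.
have := @cut_width_perturb K r0 r1 x x' dt e r00 (ltW dt0) e0 bK rK Kr Dx Dx'.
move=> H; have {}H : cut_width K x <= (1 + e) * cut_width K x'.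
  apply: H => [i|]; last by rewrite /dt divfK// gt_eqF.
  have [xi1 xi2] := xb i; have [x'i1 x'i2] := x'b i.
  set q := b.1 i in xi1 xi2 x'i1 x'i2.
  move: xi1 x'i1 xi2 x'i2; rewrite -!ball_normE /ball_/= => xi1 x'i1 xi2 x'i2.
  have k0 : 0 <= k.+1%:R^-1 :> R by rewrite invr_ge0.
  split.
    apply: le_trans kd; apply: (le_trans (enorm_le_norm _)).
    apply: (@le_trans _ _ (n%:R * (k.+1%:R^-1 + k.+1%:R^-1))).
      rewrite ler_wpM2l//; apply: (le_trans (ler_distD (map_mx ratr q.1) _ _)).
      by rewrite lerD ?(ltW x'i1)// distrC ltW.
    by rewrite ler_wpM2r ?addr_ge0// lerDl.
  apply: le_trans kd; apply: (le_trans (ler_distD (ratr q.2) _ _)).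
  rewrite (@le_trans _ _ (k.+1%:R^-1 + k.+1%:R^-1))//.
    by rewrite lerD ?(ltW x'i2)// distrC ltW.
  by rewrite ler_peMl ?addr_ge0// lerDr.
rewrite -(@ltr_pM2l _ (1 + e)) ?addr_gt0//.
exact: lt_le_trans H.
Qed.

End cut_width.

(** * The random polytope in coordinates *)

Section negligible_comparison.
Context d (T : measurableType d) (R : realType) (P : {measure set T -> \bar R}).
Import HBNNSimple.

(** The integral of a nonnegative function is a supremum over simple functions,
    which may be set to zero on a null set. The comparison is meant for the
    width of the random polytope, which may fail to be measurable on the null
    event that a sampled hyperplane is not near the body. *)
Lemma le_integral_off_negligible (f g : T -> \bar R) (A : set T) :
  (forall w, 0 <= f w)%E -> (forall w, 0 <= g w)%E -> measurable A -> P (~` A) = 0%E ->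
  (forall w, A w -> f w <= g w)%E -> (\int[P]_w f w <= \int[P]_w g w)%E.
Proof.
move=> f0 g0 mA A0 fg; rewrite ge0_integralTE//; apply: ge_ereal_sup => _ [h hf <-].
have -> : sintegral P h = sintegral P (h \_ A).
  transitivity (sintegral P (h \_ setT)); first by rewrite patch_setT.
  rewrite -!integral_nnsfun//.
  rewrite (@ge0_negligible_integral _ _ _ P setT (~` A)) ?setTD ?setCK//.
  - exact: measurableC.
  - by apply/measurable_EFinP.
  - by move=> w _; rewrite lee_fin.
rewrite ge0_integralTE//; apply: ereal_sup_ubound.
exists (proj_nnsfun h mA) => /= [w|]; last by rewrite mrestrict.
have /(congr1 (@^~ w)) := mrestrict h mA; rewrite /= => <-; rewrite patchE.
by case: ifP => // /set_mem Aw; exact: le_trans (hf w) (fg _ Aw).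
Qed.

End negligible_comparison.

Section circumscribed_bodies.
Context (R : realType) (d : nat) (hd : (2 <= d.+1)%N) (N : nat).
Local Notation n := d.+1.
Variable mu : {measure set (borelH R d) -> \bar R}.
Hypothesis mu_inv : motion_invariant mu.
Hypothesis mu_norm : width_normalized mu.
Implicit Types (K L M : set 'rV[R]_n) (p : 'rV[R]_n).
Local Notation polarT := (borelRn R n * measurableTypeR R)%type.
Local Notation sampleR := (sampleT polarT N).
Local Notation D := (@admissible_sample R d N).

Lemma cut_width_ge0 K (x : sampleR) : convex_body K -> D x -> 0 <= cut_width K x.
Proof. by move=> bK Dx; apply: (mean_width_ge0 mu_norm); exact: cut_convex_body. Qed.

Lemma cut_width_move Q p K (x : sampleR) : rotation Q -> convex_body K -> D x ->
  cut_width (move Q p @` K) (rotate_sample Q x) = cut_width K x.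
Proof.
move=> rQ bK Dx; rewrite /cut_width cut_move//; last by case: rQ.
by rewrite (mean_width_move mu_inv mu_norm p rQ)//; exact: cut_convex_body.
Qed.

Lemma rotate_sample1 (x : sampleR) : rotate_sample 1%:M x = x.
Proof. by apply/funext => i; rewrite /rotate_sample mulmx1; case: (x i). Qed.

Lemma cut_width_translate p K (x : sampleR) : convex_body K -> D x ->
  cut_width (move 1%:M p @` K) x = cut_width K x.
Proof.
by move=> bK Dx; rewrite -{1}(rotate_sample1 x) cut_width_move//; exact: rotation1.
Qed.

(** Superadditivity of cut bodies turns into concavity because mean width is
    additive and increasing. *)
Lemma cut_width_minkowski a b M M' (x : sampleR) : 0 <= a -> 0 <= b -> a + b = 1 ->
  convex_body M -> convex_body M' -> D x ->
  a * cut_width M x + b * cut_width M' x <= cut_width (minkowski a M b M') x.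
Proof.
move=> a0 b0 ab bM bM' Dx.
have cM := cut_convex_body bM Dx; have cM' := cut_convex_body bM' Dx.
rewrite -mean_width_minkowski//; apply: mean_width_sub.
- exact: minkowski_convex_body.
- by apply: cut_convex_body => //; exact: minkowski_convex_body.
- exact: cut_minkowski.
Qed.

Lemma admissible_rotate Q (x : sampleR) : orthogonal_mx Q ->
  D (rotate_sample Q x) <-> D x.
Proof.
by move=> oQ; split => h i; have := h i; rewrite /= orthogonal_enorm.
Qed.

(** Whatever the hyperplanes are, each [Hminus] is an intersection of closed
    halfspaces containing [K]; in particular the mean width is nonnegative at
    every outcome, which makes the expectation an integral of a nonnegative
    function. *)
Lemma circumscribed_convex_body K (H : 'I_N -> hyperplane R n) : convex_body K ->
  convex_body (circumscribed K H).
Proof.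
move=> bK; have [[p Kp] _ _] := bK.
have /convex_bodyP[_ cK1 vK1] := parallel_body_convex_body bK.
have mem_Hminus y i : Hminus K (H i) y <-> (forall u t, u != 0 ->
    points (H i) = hplane u t -> (forall z, K z -> dot z u <= t) -> dot y u <= t).
  split=> [h u t u0 Hut Kut|h _ [[u [t [u0 Hut ->]]] KG]].
    by apply: (h [set x | dot x u <= t]); split; first by exists u, t.
  exact: h.
split.
- exists p; split; last exact: sub_parallel_body.
  by move=> i _; apply/mem_Hminus => u t _ _; apply.
- apply: (@subclosed_compact _ _ (parallel_body K)) => //; last by move=> y [].
  apply: closedI; last by apply: compact_closed => //; exact: norm_hausdorff.
  apply: closed_bigI => i _; apply: closed_bigI => _ [[u [t [_ _ ->]]] _].
  apply: (@closed_comp _ _ (fun y => dot y u) [set s | s <= t]); last exact: closed_le.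
  by move=> y _; exact: continuous_dotl.
- apply/convex_setP => y z t t01 [Hy y1] [Hz z1]; split; last exact: vK1.
  move=> i _; apply/mem_Hminus => u s u0 Hus Kus.
  have /mem_Hminus/(_ u s u0 Hus Kus) yu := Hy i I.
  have /mem_Hminus/(_ u s u0 Hus Kus) zu := Hz i I.
  have /andP[t0 t1] := t01; rewrite dotDl !dotZl.
  have := ler_wpM2l t0 yu.
  have := @ler_wpM2l _ (1 - t) _ _ _ zu; rewrite subr_ge0 => /(_ t1); lra.
Qed.

Lemma circumscribed_cut K p (H : 'I_N -> hyperplane R n) : convex_body K -> K° p ->
  D (fun i => coordinates K p (H i)) ->
  circumscribed K H = cut K (fun i => coordinates K p (H i)).
Proof.
move=> bK Kp DH.
have HE i : Hminus K (H i) = [set y | dot y (coordinates K p (H i)).1 <=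
    support_function K (coordinates K p (H i)).1 + (coordinates K p (H i)).2].
  apply: Hminus_coordinates => //; apply/(near_coordinates (H i) bK Kp).
  by have [Su s01] := DH i; split => //=; rewrite in_itv.
apply/seteqP; split => y [h1 h2]; split => // i.
  by have := h1 i I; rewrite HE.
by move=> _; rewrite HE; exact: h1.
Qed.

Section sample.
Variables (K : set 'rV[R]_n) (bK : convex_body K) (s : hyperplane_sample mu K N).

Definition sample_coordinates p : outcome s -> sampleR :=
  fun w i => coordinates K p (hyps s i w).

Lemma measurable_sample_coordinates p : measurable_fun [set: outcome s] (sample_coordinates p).
Proof.
apply: (@measurable_fun_sample _ polarT N _ _ (fun i w => coordinates K p (hyps s i w))) => i.
by apply: (measurableT_comp (measurable_coordinates p bK)); exact: hyps_measurable.
Qed.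

Definition sample_law p : {measure set sampleR -> \bar R} :=
  image_measure (measurable_sample_coordinates p) (prob s).

Lemma sample_law_rectangle p (A : 'I_N -> set polarT) : K° p -> (forall i, measurable (A i)) ->
  sample_law p [set x | forall i, A i (x i)] = (\prod_(i < N) coordinate_law mu (A i))%E.
Proof.
move=> Kp mA.
transitivity (prob s [set w | forall i, A i (coordinates K p (hyps s i w))]); first by [].
apply: (independent_rectangle (hyps_independent s) (measurable_coordinates p bK) _ mA).
move=> i B mB; rewrite hyps_law; first exact: (muK_coordinates hd mu_inv mu_norm).
by rewrite -[X in measurable X]setTI; exact: (measurable_coordinates p bK).
Qed.

Lemma sample_law_setT p : sample_law p setT = 1%E.
Proof.
transitivity (prob s (sample_coordinates p @^-1` setT)); first by [].
by rewrite preimage_setT probability_setT.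
Qed.

(** [coordinate_law] is carried by the admissible coordinates, and its total mass
    appears in the same product formula. *)
Lemma sample_law_admissible p : K° p -> sample_law p (~` D) = 0%E.
Proof.
move=> Kp.
have mC : measurable ((@unit_sphere R n : set (borelRn R n)) `*`
    (`[0%R, 1%R]%classic : set (measurableTypeR R))).
  by apply: measurableX; [exact: measurable_unit_sphere|exact: measurable_itv].
have D1 : sample_law p D = 1%E.
  transitivity (\prod_(i < N) coordinate_law mu (((@unit_sphere R n : set (borelRn R n)) `*`
    (`[0%R, 1%R]%classic : set (measurableTypeR R)))))%E.
    exact: (sample_law_rectangle Kp (fun=> mC)).
  transitivity (\prod_(i < N) coordinate_law mu setT)%E.
    apply: eq_bigr => i _; rewrite /coordinate_law; congr (_ * polar_measure mu 0 _)%E.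
    apply/seteqP; split => q [_ [Sq q01]]; split => //; split => //.
    by move: q01; rewrite /= !in_itv/= => /andP[/ltW -> ->].
  rewrite -(@sample_law_rectangle p (fun=> setT) Kp) => [|_]; last exact: measurableT.
  rewrite -[RHS](sample_law_setT p); congr (sample_law p _).
  by apply/seteqP; split.
have mD := @measurable_admissible R d N.
have disj : D `&` ~` D = set0 by rewrite setICr.
have := measureU (sample_law p) mD (measurableC mD) disj.
rewrite setUv [LHS](sample_law_setT p) [X in (X + _)%E]D1.
have arith (x : \bar R) : (1 = 1 + x -> x = 0)%E.
  case: x => [r| |]//; rewrite -EFinD => -[h].
  by congr EFin; move: h; lra.
exact: arith.
Qed.

(** Outside a null event all sampled hyperplanes are near [K] and the random
    polytope is the cut body of the sample coordinates. *)
Lemma expectation_circumscribed p : K° p ->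
  measurable_fun D (cut_width K : sampleR -> measurableTypeR R) ->
  ('E_(prob s)[fun w => mean_width (circumscribed K (fun i => hyps s i w))] =
   \int[sample_law p]_(x in D) (cut_width K x)%:E)%E.
Proof.
move=> Kp mF; have mD := @measurable_admissible R d N.
have mX := measurable_sample_coordinates p.
rewrite unlock.
rewrite (@ge0_integral_image _ _ _ _ R _ mX (prob s) (sample_law p) D); first last.
- by move=> x Dx; rewrite lee_fin cut_width_ge0.
- exact/measurable_EFinP.
- exact: mD.
- by [].
have mXD : measurable (sample_coordinates p @^-1` D).
  by rewrite -[X in measurable X]setTI; exact: mX.
rewrite [RHS]integral_mkcond.
have circ0 w : (0 <= (mean_width (circumscribed K (fun i => hyps s i w)))%:E)%E.
  by rewrite lee_fin (mean_width_ge0 mu_norm)//; exact: circumscribed_convex_body.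
have g0 w : (0 <= ((fun w => (cut_width K (sample_coordinates p w))%:E) \_
    (sample_coordinates p @^-1` D)) w)%E.
  by rewrite patchE; case: ifP => // /set_mem Dw; rewrite lee_fin cut_width_ge0.
have null : prob s (~` (sample_coordinates p @^-1` D)) = 0%E.
  exact: (sample_law_admissible Kp).
have E w : (sample_coordinates p @^-1` D) w ->
    mean_width (circumscribed K (fun i => hyps s i w)) = cut_width K (sample_coordinates p w).
  by move=> Dw; rewrite (@circumscribed_cut K p).
apply/eqP; rewrite eq_le; apply/andP; split.
  apply: (le_integral_off_negligible _ _ mXD null) => // w Dw.
  by rewrite patchE mem_set// E.
apply: (le_integral_off_negligible _ _ mXD null) => // w Dw.
by rewrite patchE mem_set// E.
Qed.

End sample.

(** The law on boxes is a product of values of [coordinate_law], in which the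
    body does not occur. *)
Lemma sample_law_unique K K' (bK : convex_body K) (bK' : convex_body K')
    (s : hyperplane_sample mu K N) (s' : hyperplane_sample mu K' N) p p' :
  K° p -> K'° p' -> forall A, measurable A -> sample_law bK s p A = sample_law bK' s' p' A.
Proof.
move=> Kp Kp'; apply: rectangle_law_unique.
  by rewrite [X in (X < _)%E](sample_law_setT bK s p) ltry.
move=> A mA.
transitivity (\prod_(i < N) coordinate_law mu (A i))%E; first exact: sample_law_rectangle.
by apply/esym; exact: sample_law_rectangle.
Qed.

Lemma measurable_rotate_sample Q : orthogonal_mx Q ->
  measurable_fun [set: sampleR] (rotate_sample Q : sampleR -> sampleR).
Proof.
move=> oQ; apply: (@measurable_fun_sample _ polarT N _ sampleR (fun i x => rotate_dir Q (x i))) => i.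
have mi : measurable_fun [set: sampleR] ((fun x => x i) : sampleR -> polarT).
  move=> _ B mB; rewrite setTI.
  rewrite (_ : _ @^-1` B = [set x | forall j, (if j == i then B else setT) (x j)]).
    apply: (@measurable_rectangle _ polarT N (fun j => if j == i then B else setT)).
    by move=> j; case: ifP.
  apply/seteqP; split => x /= h; last by have := h i; rewrite eqxx.
  by move=> j; case: eqP => // ->.
exact: (measurableT_comp (measurable_rotate_dir oQ) mi).
Qed.

Lemma sample_law_rotate K (bK : convex_body K) (s : hyperplane_sample mu K N) p Q A :
  K° p -> rotation Q -> measurable A ->
  sample_law bK s p A = sample_law bK s p ((rotate_sample Q : sampleR -> sampleR) @^-1` A).
Proof.
move=> Kp rQ mA; have [oQ _] := rQ; have mQ := measurable_rotate_sample oQ.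
transitivity (image_measure mQ (sample_law bK s p) A); last by [].
move: A mA; apply: rectangle_law_unique.
  by rewrite [X in (X < _)%E](sample_law_setT bK s p) ltry.
move=> A mA; transitivity (\prod_(i < N) coordinate_law mu (A i))%E.
  exact: sample_law_rectangle.
transitivity (sample_law bK s p [set x | forall i, (rotate_dir Q @^-1` A i) (x i)]); last by [].
transitivity (\prod_(i < N) coordinate_law mu (rotate_dir Q @^-1` A i))%E.
  by apply: eq_bigr => i _; rewrite (coordinate_law_rotate mu_inv rQ).
apply/esym; apply: sample_law_rectangle => // i.
by rewrite -[X in measurable X]setTI; exact: measurable_rotate_dir.
Qed.

End circumscribed_bodies.

(** * Balls maximize the expected mean width *)

Section maximality_of_balls.
Context (R : realType) (d : nat) (hd : (2 <= d.+1)%N) (N : nat).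
Local Notation n := d.+1.
Variable mu : {measure set (borelH R d) -> \bar R}.
Hypothesis mu_inv : motion_invariant mu.
Hypothesis mu_norm : width_normalized mu.
Implicit Types (K L M : set 'rV[R]_n) (p : 'rV[R]_n).
Local Notation polarT := (borelRn R n * measurableTypeR R)%type.
Local Notation sampleR := (sampleT polarT N).
Local Notation D := (@admissible_sample R d N).
Variable law : {measure set sampleR -> \bar R}.
Hypothesis law_rot : forall Q A, rotation Q -> measurable A ->
  law A = law ((rotate_sample Q : sampleR -> sampleR) @^-1` A).

Let J K : \bar R := (\int[law]_(x in D) (cut_width K x)%:E)%E.

Let mD : measurable D. Proof. exact: measurable_admissible. Qed.

Let measurable_integrand r0 K : 0 < r0 -> convex_body K -> eball 0 r0 `<=` K ->
  measurable_fun D (fun x : sampleR => (cut_width K x)%:E).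
Proof. by move=> r00 bK rK; apply/measurable_EFinP; exact: (measurable_cut_width r00 bK rK). Qed.

Let integrand_ge0 K x : convex_body K -> D x -> (0 <= (cut_width K x)%:E)%E.
Proof. by move=> bK Dx; rewrite lee_fin (cut_width_ge0 mu_norm). Qed.

Let eball_move0 Q r : orthogonal_mx Q -> eball 0 r `<=` move Q 0 @` eball (0 : 'rV[R]_n) r.
Proof.
move=> oQ y yr; exists (y *m Q^T); last by rewrite /move orthogonal_mulVK// addr0.
move: yr; rewrite /eball/= !subr0 orthogonal_enorm//; exact: orthogonal_tr.
Qed.

(** Rotating the body amounts to rotating the sample, which preserves the law. *)
Let J_rotate r0 K Q : 0 < r0 -> convex_body K -> eball 0 r0 `<=` K -> rotation Q ->
  J (move Q 0 @` K) = J K.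
Proof.
move=> r00 bK rK rQ; have [oQ _] := rQ; have bQK := move_convex_body 0 oQ bK.
have rQK : eball 0 r0 `<=` move Q 0 @` K.
  by apply: (subset_trans (@eball_move0 Q r0 oQ)) => _ [y yr <-]; exists y => //; exact: rK.
rewrite /J (@ge0_integral_image _ _ _ _ R _ (@measurable_rotate_sample R d N Q oQ) law law D); first last.
- by move=> x Dx; exact: integrand_ge0.
- exact: measurable_integrand r00 bQK rQK.
- exact: mD.
- by move=> A mA; exact: law_rot.
rewrite (_ : _ @^-1` D = D); last first.
  by apply/seteqP; split => x; rewrite /preimage/= admissible_rotate.
by apply: eq_integral => x /set_mem Dx; rewrite (cut_width_move mu_inv mu_norm).
Qed.

Let J_scale (c : R) K : 0 <= c -> convex_body K ->
  measurable_fun D (fun x : sampleR => (cut_width K x)%:E) ->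
  (\int[law]_(x in D) (c%:E * (cut_width K x)%:E) = c%:E * J K)%E.
Proof.
move=> c0 bK mK; apply: (ge0_integralZl law mD mK) => [x Dx|].
  exact: integrand_ge0.
by rewrite lee_fin.
Qed.

Let lee_half_sum (I a b : \bar R) : (0 <= I -> I <= a -> I <= b ->
  I <= 2^-1%:E * a + 2^-1%:E * b)%E.
Proof.
move=> I0 Ia Ib; have h2 : (0 <= 2^-1%:E :> \bar R)%E by rewrite lee_fin invr_ge0.
apply: (@le_trans _ _ (2^-1%:E * I + 2^-1%:E * I)%E).
  by rewrite -ge0_muleDl// -EFinD (_ : 2^-1 + 2^-1 = 1 :> R) ?mul1e//; lra.
by apply: leeD; exact: lee_wpmul2l.
Qed.

Let J_half r0 M M' : 0 < r0 -> convex_body M -> eball 0 r0 `<=` M ->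
  convex_body M' -> eball 0 r0 `<=` M' ->
  forall I : \bar R, (0 <= I)%E -> (I <= J M)%E -> (I <= J M')%E ->
  (I <= J (minkowski 2^-1 M 2^-1 M'))%E.
Proof.
move=> r00 bM rM bM' rM' I I0 IM IM'.
have h0 : 0 <= 2^-1 :> R by rewrite invr_ge0.
have h1 : 2^-1 + 2^-1 = 1 :> R by lra.
have bL : convex_body (minkowski 2^-1 M 2^-1 M') by exact: minkowski_convex_body.
have rL : eball 0 r0 `<=` minkowski 2^-1 M 2^-1 M'.
  move=> y yr; exists y; first exact: rM.
  by exists y; [exact: rM'|rewrite -scalerDl h1 scale1r].
have mM := measurable_integrand r00 bM rM; have mM' := measurable_integrand r00 bM' rM'.
have mZ (K : set 'rV[R]_n) : measurable_fun D (fun x : sampleR => (cut_width K x)%:E) ->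
    measurable_fun D (fun x : sampleR => (2^-1%:E * (cut_width K x)%:E)%E).
  by move=> mK; apply: emeasurable_funM => //; exact: measurable_cst.
have Z0 (K : set 'rV[R]_n) (x : sampleR) : convex_body K -> D x ->
    (0 <= 2^-1%:E * (cut_width K x)%:E)%E.
  by move=> bK Dx; rewrite mule_ge0 ?lee_fin// (cut_width_ge0 mu_norm).
apply: (le_trans (lee_half_sum I0 IM IM')).
have E : (\int[law]_(x in D) (2^-1%:E * (cut_width M x)%:E + 2^-1%:E * (cut_width M' x)%:E)
    = 2^-1%:E * J M + 2^-1%:E * J M')%E.
  rewrite (ge0_integralD law mD (fun x Dx => Z0 M x bM Dx) (mZ _ mM)
    (fun x Dx => Z0 M' x bM' Dx) (mZ _ mM')).
  by congr (_ + _)%E; exact: J_scale.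
rewrite -E.
apply: ge0_le_integral => //.
- by move=> x Dx; rewrite adde_ge0// Z0.
- by apply: emeasurable_funD; exact: mZ.
- exact: measurable_integrand r00 bL rL.
- move=> x Dx; rewrite -!EFinM -EFinD lee_fin.
  exact: (cut_width_minkowski).
Qed.

Let J_eball r e L : 0 < r -> 0 < e -> convex_body L ->
  (exists2 r0, 0 < r0 & eball 0 r0 `<=` L) ->
  (forall u, unit_sphere u -> support_function L u <= r + e) ->
  (J L <= (1 + e / r)%:E * J (eball 0 r))%E.
Proof.
move=> r0 e0 bL [r1 r10 rL] hL.
have re0 : 0 <= r + e by rewrite addr_ge0// ltW.
have bre := eball_convex_body (0 : 'rV[R]_n) re0.
have br := eball_convex_body (0 : 'rV[R]_n) (ltW r0).
have LB : L `<=` eball 0 (r + e).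
  move=> y Ly; rewrite /eball/= subr0.
  have [->|y0] := eqVneq y 0; first by rewrite enorm0.
  have ey : 0 < enorm y by rewrite enorm_gt0.
  have Su : unit_sphere ((enorm y)^-1 *: y).
    by rewrite /unit_sphere/= enormZ ger0_norm ?invr_ge0 ?(ltW ey)// mulVf// gt_eqF.
  have [_ cL _] := bL; have := le_trans (support_function_ge _ cL Ly) (hL _ Su).
  by rewrite dotZr -sqr_enorm expr2 mulKf// gt_eqF.
have c0 : 0 <= 1 + e / r by rewrite addr_ge0// divr_ge0// ltW.
have mr := measurable_integrand r0 br (@subset_refl _ (eball 0 r)).
rewrite -(J_scale c0 br mr).
apply: ge0_le_integral => //.
- by move=> x Dx; exact: integrand_ge0.
- exact: measurable_integrand r10 bL rL.
- by apply: emeasurable_funM => //; exact: measurable_cst.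
- move=> x Dx; rewrite -EFinM lee_fin.
  have cr := cut_convex_body br Dx.
  rewrite /cut_width -mean_widthZ//; apply: mean_width_sub.
  + exact: cut_convex_body.
  + exact: minkowski_convex_body.
  + apply: subset_trans (cut_eball_sub r0 e0 Dx).
    exact: cut_sub.
Qed.

Let lee_of_dilations (I Jr : \bar R) r : 0 < r -> (0 <= Jr)%E ->
  (forall e, 0 < e -> (I <= (1 + e / r)%:E * Jr)%E) -> (I <= Jr)%E.
Proof.
move=> r0; case: Jr => [j| |] // j0 h; last by rewrite leey.
apply/lee_addgt0Pr => e e0; move: j0; rewrite lee_fin => j0.
have j1 : 0 < j + 1 by rewrite ltr_wpDl.
have ej : 0 < e * r / (j + 1) by rewrite !mulr_gt0// invr_gt0.
apply: (le_trans (h _ ej)); rewrite -EFinM -EFinD lee_fin mulrDl mul1r lerD2l.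
rewrite [X in X * j](_ : _ = e / (j + 1)); last by field; rewrite !gt_eqF.
by rewrite mulrAC ler_pdivrMr// ler_wpM2l ?(ltW e0)// lerDl.
Qed.

(** The bodies obtained from [K] by rotations and Minkowski averages keep its
    mean width and, by concavity, do not decrease the expectation; by
    [averaging] some of them are nearly balls around the origin. *)
Theorem expected_width_le_ball K r0 r : 0 < r0 -> 0 < r -> convex_body K ->
  eball 0 r0 `<=` K -> mean_width K = 2 * r -> (J K <= J (eball 0 r))%E.
Proof.
move=> r00 r0' bK rK Kr.
have [_ cK _] := bK; have [r1 r10 Kr1] := compact_enorm_bounded cK.
have J0 L : convex_body L -> (0 <= J L)%E.
  by move=> bL; apply: integral_ge0 => x Dx; exact: integrand_ge0.
apply: (@lee_of_dilations _ _ r) => //; first by apply/J0/eball_convex_body/ltW.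
move=> e e0.
pose C : set (set 'rV[R]_n) := [set L | [/\ convex_body L, eball 0 r0 `<=` L,
  (forall y, L y -> enorm y <= r1), mean_width L = 2 * r & (J K <= J L)%E]].
pose G : set ('rV[R]_n -> R) := [set g | exists2 L, C L & g = support_function L].
have Glip g u v : G g -> unit_sphere u -> unit_sphere v -> g u - g v <= r1 * enorm (u - v).
  move=> [L [bL _ Lr1 _ _] ->] _ _; have [L0 cL _] := bL.
  exact: support_function_lip.
have Grot g Q : G g -> rotation Q -> G (fun u => g (u *m Q)).
  move=> [L [bL rL Lr1 WL JL] ->] rQ; have [L0 cL _] := bL.
  have rQ' := rotation_tr rQ; have [oQ' _] := rQ'.
  exists (move Q^T 0 @` L); last first.
    by apply/funext => u; rewrite support_function_move// trmxK dot0l addr0.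
  split.
  - exact: move_convex_body.
  - apply: (subset_trans (@eball_move0 Q^T r0 oQ')) => _ [y yr <-]; exists y => //.
    exact: rL.
  - by move=> _ [y Ly <-]; rewrite /move addr0 orthogonal_enorm// Lr1.
  - by rewrite (mean_width_move mu_inv mu_norm 0 rQ').
  - by rewrite (J_rotate r00 bL rL rQ').
have Ghalf g g' : G g -> G g' -> G (fun u => 2^-1 * g u + 2^-1 * g' u).
  move=> [L [bL rL Lr1 WL JL] ->] [L' [bL' rL' L'r1 WL' JL'] ->].
  have h0 : 0 <= 2^-1 :> R by rewrite invr_ge0.
  have h1 : 2^-1 + 2^-1 = 1 :> R by lra.
  have [L0 cL _] := bL; have [L'0 cL' _] := bL'.
  exists (minkowski 2^-1 L 2^-1 L'); last first.
    by apply/funext => u; rewrite support_function_minkowski.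
  split.
  - exact: minkowski_convex_body.
  - move=> y yr; exists y; first exact: rL.
    by exists y; [exact: rL'|rewrite -scalerDl h1 scale1r].
  - move=> _ [y Ly [z L'z <-]]; rewrite (le_trans (ler_enormD _ _))//.
    rewrite !enormZ !ger0_norm//; have := Lr1 _ Ly; have := L'r1 _ L'z; lra.
  - by rewrite mean_width_minkowski// WL WL'; lra.
  - exact: (J_half r00 bL rL bL' rL' (J0 _ bK) JL JL').
have [|g [L [bL rL Lr1 WL JL] ->] osc] := averaging hd Glip Grot Ghalf e0.
  by exists (support_function K), K => //; split.
apply: (le_trans JL); apply: J_eball => //; first by exists r0.
exact: (support_function_le_of_oscillation bL r0' WL osc).
Qed.

End maximality_of_balls.

Theorem theorem1p2 (R : realType) (d : nat) (hd : (2 <= d.+1)%N)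
    (mu : {measure set (borelH R d) -> \bar R})
    (mu_inv : motion_invariant mu) (mu_norm : width_normalized mu)
    (n : nat) (w : R) (hw : 0 < w) :
  (exists2 B : set 'rV[R]_d.+1, euclidean_ball B & mean_width B = w) /\
  (forall B K : set 'rV[R]_d.+1,
    euclidean_ball B -> mean_width B = w ->
    convex_body K -> K° !=set0 -> mean_width K = w ->
    forall (sB : hyperplane_sample mu B n) (sK : hyperplane_sample mu K n),
      (expected_width_ratio sK <= expected_width_ratio sB)%E).
Proof.
split.
  exists (eball 0 (w / 2)); first by exists 0, (w / 2); rewrite ?divr_gt0.
  by rewrite mean_width_eball0 ?divr_ge0 ?(ltW hw)// mulrC divfK.
move=> B K [c [r r0 BE]] Bw bK [p Kp] Kw sB sK.
have {}BE : B = eball c r by [].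
have bB : convex_body B by rewrite BE; exact/eball_convex_body/ltW.
have Bc : B° c by rewrite BE; exact: (@eball_interior _ _ _ _ r).
have w2r : w = 2 * r by rewrite -Bw BE (mean_width_eball mu_inv mu_norm)// ltW.
have [r1 r10 rK] := interior_eball Kp.
(* Both bodies are translated so that the origin is an interior point: the
   perturbation and dilatation estimates use a ball around the origin. *)
pose translate (q : 'rV[R]_d.+1) (M : set 'rV[R]_d.+1) := move 1%:M (- q) @` M.
have trE q M s : eball q s `<=` M -> eball 0 s `<=` translate q M.
  move=> sM y ys; exists (y + q); last by rewrite /move mulmx1 addrK.
  by apply: sM; rewrite /eball/= addrK; move: ys; rewrite /eball/= subr0.
have o1 : orthogonal_mx (1%:M : 'M[R]_d.+1) by case: (rotation1 R d).
have btK : convex_body (translate p K) by exact: move_convex_body.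
have rtK := trE _ _ _ rK.
have tB : translate c B = eball 0 r by rewrite BE /translate translate_eball subrr.
have measK : measurable_fun (@admissible_sample R d n)
    (cut_width K : sampleT _ n -> measurableTypeR R).
  apply: eq_measurable_fun (measurable_cut_width r10 btK rtK) => x /set_mem Dx.
  by rewrite (cut_width_translate mu_inv mu_norm).
have b0 := eball_convex_body (0 : 'rV[R]_d.+1) (ltW r0).
have measB : measurable_fun (@admissible_sample R d n)
    (cut_width B : sampleT _ n -> measurableTypeR R).
  apply: eq_measurable_fun (measurable_cut_width r0 b0 (@subset_refl _ _)) => x /set_mem Dx.
  by rewrite -tB (cut_width_translate mu_inv mu_norm).
rewrite /expected_width_ratio Kw Bw; apply: lee_wpmul2r.
  by rewrite inve_ge0 lee_fin ltW.
rewrite (expectation_circumscribed hd mu_inv mu_norm bK sK Kp measK).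
rewrite (expectation_circumscribed hd mu_inv mu_norm bB sB Bc measB).
set law := sample_law bK sK p.
rewrite [leRHS](_ : _ = \int[law]_(x in @admissible_sample R d n) (cut_width (eball 0 r) x)%:E)%E; last first.
  rewrite (@eq_measure_integral _ _ _ _ law) => [|A mA _].
    apply: eq_integral => x /set_mem Dx.
    by rewrite -tB (cut_width_translate mu_inv mu_norm).
  exact: (sample_law_unique hd mu_inv mu_norm).
rewrite [leLHS](_ : _ = \int[law]_(x in @admissible_sample R d n) (cut_width (translate p K) x)%:E)%E; last first.
  apply: eq_integral => x /set_mem Dx.
  by rewrite (cut_width_translate mu_inv mu_norm).
have law_rot (Q : 'M[R]_d.+1) A (rQ : rotation Q) (mA : measurable A) :=
  sample_law_rotate hd mu_inv mu_norm bK sK Kp rQ mA.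
apply: (expected_width_le_ball hd mu_inv mu_norm law_rot r10 r0 btK rtK).
by rewrite (mean_width_move mu_inv mu_norm _ (rotation1 R d))// Kw.
Qed.
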